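(* For B-series methods, the following statements hold: (a) Every B-series method is affine functionally equivariant. (b) B-series methods preserving quadratic invariants (e.g., Gauss--Legendre collocation methods) are quadratic functionally equivariant. (c) No B-series method is cubic functionally equivariant.
   Context: For a Banach space $Y$, $\mathfrak{X}(Y)$ denotes the (smooth) vector fields on $Y$, viewed as maps $f\colon Y\to Y$. A numerical integrator is a collection of maps $\Phi=\{\Phi_f\colon Y\to Y \mid f\in\mathfrak{X}(Y),\ Y\text{ a Banach space}\}$; $\Phi_f\colon y_0\mapsto y_1$ is one step with unit time step, and time step $\Delta t$ corresponds to $\Phi_{\Delta t f}$. A B-series method is one of the form $\Phi_{\Delta t f}(y)=y+\sum_{\tau}\frac{\Delta t^{|\tau|}}{\sigma(\tau)}a(\tau)\,\mathcal{D}_f(\tau)(y)$, where $\tau$ ranges over rooted trees, $|\tau|$ is the number of vertices, $\sigma(\tau)$ the symmetry factor, $a(\tau)\in\mathbb{R}$ are coefficients depending only on the method (not on $f$ or $Y$), and $\mathcal{D}_f(\tau)$ is the elementary differential: $\mathcal{D}_f(\bullet)=f$ and $\mathcal{D}_f([\tau_1,\dots,\tau_k])=f^{(k)}(\mathcal{D}_f(\tau_1),\dots,\mathcal{D}_f(\tau_k))$. As usual the series is a formal power series in $\Delta t$ and identities are understood in that sense. Runge--Kutta methods are B-series methods. Let $\mathcal{F}(Y,Z)$ be the set of maps $Y\to Z$ that are affine, quadratic (polynomial of degree at most $2$), or cubic (polynomial of degree at most $3$), respectively. $\Phi$ preserves quadratic invariants if $F\circ\Phi_f=F$ for all Banach spaces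 $Y,Z$, all $f\in\mathfrak{X}(Y)$ and all quadratic $F\colon Y\to Z$ with $F'(y)f(y)=0$ for all $y\in Y$. $\Phi$ is affine (respectively quadratic, cubic) functionally equivariant if for all Banach spaces $Y,Z$, all maps $F\colon Y\to Z$ in the corresponding class, and all $f\in\mathfrak{X}(Y)$, letting $g(y,z)=\bigl(f(y),F'(y)f(y)\bigr)$ on $Y\times Z$, one has $(\mathrm{id},F)\circ\Phi_f=\Phi_g\circ(\mathrm{id},F)$.
   Formalization: In (c) the B-series with a(τ)=c^|τ|/γ(τ), c real (exact flow of c·f; c=0 is the identity map), are excluded: they are cubic functionally equivariant, so (c) is false for them; every other B-series method is shown not to be cubic functionally equivariant. *)

(* Defs.v *)
From HB Require Import structures.
From mathcomp Require Import all_boot all_order all_algebra.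
From mathcomp Require Import all_classical all_reals all_analysis.

Set Implicit Arguments.
Unset Strict Implicit.
Unset Printing Implicit Defensive.
Import Order.TTheory GRing.Theory Num.Theory.
Import numFieldNormedType.Exports.
Local Open Scope classical_set_scope.
Local Open Scope ring_scope.

Inductive ptree : Type := Node of seq ptree.

Lemma ptree_all_ind (P : ptree -> Prop) :
  (forall ts, foldr (fun t Q => P t /\ Q) True ts -> P (Node ts)) ->
  forall t, P t.
Proof.
by move=> PN; fix IH 1; case=> ts; apply: PN; elim: ts => //= t ts IHts; split.
Qed.

Fixpoint ptree_encode (t : ptree) : GenTree.tree unit :=
  let: Node ts := t in GenTree.Node 0 (map ptree_encode ts).

Fixpoint ptree_decode (t : GenTree.tree unit) : ptree :=
  if t is GenTree.Node _ ts then Node (map ptree_decode ts) else Node [::].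

Lemma ptree_encodeK : cancel ptree_encode ptree_decode.
Proof.
elim/ptree_all_ind => ts IH /=; congr Node.
elim: ts IH => //= t ts IHts IH.
by case: IH => -> /IHts ->.
Qed.

HB.instance Definition _ := Countable.copy ptree (can_type ptree_encodeK).

Fixpoint nb_vertices (t : ptree) : nat :=
  let: Node ts := t in (sumn (map nb_vertices ts)).+1.

(* [canonical] fixes one ordering of every multiset of children, so that it
   selects exactly one plane tree in each isomorphism class of (unordered)
   rooted trees. *)
Fixpoint canonical (t : ptree) : bool :=
  let: Node ts := t in
  sorted (fun s t => (pickle s <= pickle t)%N) ts && all canonical ts.

Record rtree : Type := RTree { plane :> ptree; _ : canonical plane }.

HB.instance Definition _ := [isSub for plane].
HB.instance Definition _ := [Countable of rtree by <:].

(* sigma [t_1 ^ m_1, .., t_k ^ m_k] = prod_i m_i! * sigma(t_i) ^ m_i, the t_i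
   being pairwise distinct; on canonical trees equality is isomorphism. *)
Fixpoint symmetry (t : ptree) : nat :=
  let: Node ts := t in
  (\prod_(s <- undup ts) (count_mem s ts)`! * foldr muln 1 (map symmetry ts))%N.

(* The tree factorial gamma(t) = |t| * prod_i gamma(t_i). *)
Fixpoint tree_factorial (t : ptree) : nat :=
  let: Node ts := t in
  (nb_vertices t * foldr muln 1 (map tree_factorial ts))%N.

Definition trees_of_order (n : nat) : set rtree := [set t | nb_vertices t = n].

Lemma finite_seqs (T : choiceType) (A : set T) k : finite_set A ->
  finite_set [set s : seq T | size s = k /\ forall x, x \in s -> A x].
Proof.
move=> finA; elim: k => [|k IHk].
  by apply: (sub_finite_set _ (finite_set1 [::])) => s /= [/size0nil].
apply: (sub_finite_set _ (finite_image2 cons finA IHk)) => -[|x s] //= [] //.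
move=> [sk] Axs; exists x; first by apply: Axs; rewrite mem_head.
by exists s => //; split=> // y ys; apply: Axs; rewrite inE ys orbT.
Qed.

Lemma finite_trees_of_order n : finite_set (trees_of_order n).
Proof.
suff finP : finite_set [set t : ptree | (nb_vertices t <= n)%N].
  apply: (@finite_preimage _ _ [set t | nb_vertices t = n] plane) => [s t _ _|].
    exact: val_inj.
  by apply: sub_finite_set finP => t /= ->.
elim: n => [|n IHn].
  by apply: (sub_finite_set _ (@finite_set0 _)) => -[].
have finS : finite_set (\bigcup_(k in `I_n.+1)
    [set ts : seq ptree | size ts = k /\ forall t, t \in ts -> (nb_vertices t <= n)%N]).
  by apply: bigcup_finite => // k _; apply: finite_seqs.
apply: (sub_finite_set _ (finite_image Node finS)) => -[ts] /=; rewrite ltnS => le_ts.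
exists ts => //; exists (size ts) => /=; last split=> // t.
  rewrite ltnS; apply: leq_trans le_ts.
  by elim: ts => //= -[us] ts IHts /=; rewrite addSn ltnS (leq_trans IHts) ?leq_addl.
move=> t_ts; apply: leq_trans le_ts.
by elim: ts t_ts => //= s ts IHts; rewrite inE => /predU1P[->|/IHts];
  [rewrite leq_addr|move/leq_trans; apply; rewrite leq_addl].
Qed.

Section ProductComplete.
Context {R : realType} (Y Z : completeNormedModType R).

Lemma prod_cauchy_cvg
    (F : set_system ((Y * Z)%type : normedModType R)) :
  ProperFilter F -> cauchy F -> cvg F.
Proof.
move=> FF /cauchyP Fc.
have c1 : cvg (fst @ F).
  apply: cauchy_cvg; apply/cauchyP => e e0; have [p Fp] := Fc e e0.
  exists p.1; rewrite /fmap /=.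
  by apply: (@filterS _ F _ (ball p e)) => // q [].
have c2 : cvg (snd @ F).
  apply: cauchy_cvg; apply/cauchyP => e e0; have [p Fp] := Fc e e0.
  exists p.2; rewrite /fmap /=.
  by apply: (@filterS _ F _ (ball p e)) => // q [].
apply/cvg_ex; exists (lim (fst @ F), lim (snd @ F)).
apply/fcvg_ballP => e e0.
have F1 : F (fst @^-1` ball (lim (fst @ F)) e) by exact: (cvg_ball c1).
have F2 : F (snd @^-1` ball (lim (snd @ F)) e) by exact: (cvg_ball c2).
by apply: filterS2 F1 F2 => p; split.
Qed.

HB.instance Definition _ :=
  Uniform_isComplete.Build (Y * Z)%type prod_cauchy_cvg.

End ProductComplete.

Section Maps.
Context {R : realType}.
Implicit Types Y Z : completeNormedModType R.

Definition bounded_multilinear Y Z k (M : k.-tuple Y -> Z) : Prop :=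
  (forall (i : 'I_k) (vs : k.-tuple Y) (c : R) (u v : Y),
     let subst w := [tuple if j == i then w else tnth vs j | j < k] in
     M (subst (c *: u + v)) = c *: M (subst u) + M (subst v)) /\
  (exists C : R, forall vs, `|M vs| <= C * \prod_(v <- vs) `|v|).

(* [D k y] is the [k]-th Frechet derivative of [f] at [y]: the last clause
   spells out that [y |-> D k y] is Frechet differentiable, for the operator
   norm of [k]-linear maps, with differential [h |-> D k.+1 y (h :: _)]. *)
Definition derivatives Y Z (f : Y -> Z) (D : forall k, Y -> k.-tuple Y -> Z) :=
  [/\ forall y vs, D 0 y vs = f y,
      forall k y, bounded_multilinear (D k y) &
      forall k y (e : R), 0 < e -> \forall h \near (0 : Y),
        forall vs : k.-tuple Y,
        `|D k (y + h) vs - D k y vs - D k.+1 y [tuple of h :: vs]|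
          <= e * `|h| * \prod_(v <- vs) `|v| ].

Definition smooth Y Z (f : Y -> Z) : Prop := exists D, derivatives f D.

(* f^(k)(y)(v_1, .., v_k); see [nderivE] below. *)
Definition nderiv Y Z (f : Y -> Z) (vs : seq Y) : Y -> Z :=
  foldr (fun v (g : Y -> Z) y => 'd g y v) f vs.

Lemma tuple_subst0 (T : Type) k (h : T) (vs : k.-tuple T) w :
  [tuple if j == ord0 then w else tnth [tuple of h :: vs] j | j < k.+1]
    = [tuple of w :: vs].
Proof.
apply: eq_from_tnth => j; rewrite tnth_mktuple.
by case: (unliftP ord0 j) => [i|] ->; rewrite ?eqxx // !tnthS.
Qed.

Lemma nderivE Y Z (f : Y -> Z) D : derivatives f D ->
  forall k (vs : k.-tuple Y) y, nderiv f vs y = D k y vs.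
Proof.
move=> [D0 Dml Dd]; elim=> [vs|k IHk [[|v vs] //= sz]] y.
  by rewrite D0 tuple0.
have szk : size vs == k by [].
set ws := Tuple szk.
have -> : nderiv f vs = fun x => D k x ws by apply/funext => x; rewrite -IHk.
pose df h := D k.+1 y [tuple of h :: ws].
have dflin : linear df.
  move=> c u w; have [/(_ ord0 [tuple of 0 :: ws] c u w) /= lin _] := Dml k.+1 y.
  by move: lin; rewrite !tuple_subst0.
pose Ldf := HB.pack_for {linear Y -> Z} df (GRing.isLinear.Build R Y Z *:%R df dflin).
have Lc : continuous Ldf.
  apply: bounded_linear_continuous.
  have [_ [C HC]] := Dml k.+1 y.
  apply/linear_boundedP; near=> r => x.
  apply: (le_trans (HC _)); rewrite /= big_cons mulrCA mulrC.
  apply: ler_wpM2r => //; near: r; exact: nbhs_pinfty_ge.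
have Dw : (fun x => D k x ws) \o shift y
    = cst (D k y ws) + Ldf +o_ (0 : Y) id.
  apply/eqaddoP => e e0; set C := \prod_(v <- ws) `|v|.
  have C0 : 0 <= C by apply: prodr_ge0.
  have eC : 0 < e / (C + 1) by rewrite divr_gt0 ?ltr_wpDl.
  apply: filterS (Dd k y _ eC) => h /(_ ws) /=.
  have -> : ((fun x => D k x ws) \o shift y - (cst (D k y ws) + Ldf)) h
      = D k (y + h) ws - D k y ws - D k.+1 y [tuple of h :: ws].
    by rewrite !fctE /= /df opprD addrA (addrC h).
  move=> /le_trans; apply.
  rewrite -/C mulrAC ler_wpM2r // mulrAC ler_pdivrMr ?ltr_wpDl //.
  by rewrite ler_wpM2l ?lerDl // ltW.
rewrite (diff_unique Lc Dw) /= /df; congr D; exact: val_inj.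
Unshelve. all: by end_near. Qed.

Definition affine Y Z (F : Y -> Z) : Prop :=
  exists L : {linear Y -> Z}, continuous L /\ forall y, F y = F 0 + L y.

Definition polynomial (d : nat) Y Z (F : Y -> Z) : Prop :=
  exists M : forall k, k.-tuple Y -> Z,
    (forall k, bounded_multilinear (M k)) /\
    forall y, F y = \sum_(k < d.+1) M k [tuple of nseq k y].

Definition quadratic Y Z (F : Y -> Z) : Prop := polynomial 2 F.
Definition cubic Y Z (F : Y -> Z) : Prop := polynomial 3 F.

(* A formal power series  sum_n t^n u_n  is the sequence of its coefficients. *)

Definition cst_series Y (y : Y) : nat -> Y := fun n => if n == 0%N then y else 0.

(* The formal (Taylor) expansion of F(sum_n t^n u_n): its coefficient of order
   n only depends on u_0, .., u_n. *)
Definition series_comp Y Z (F : Y -> Z) (u : nat -> Y) : nat -> Z := fun n =>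
  n`!%:R^-1 *: derive1n n (fun t : R => F (\sum_(k < n.+1) t ^+ k *: u k)) 0.

(* [Phi Y f y n] is the coefficient of t^n in Phi_{t f}(y). *)
Definition integrator : Type :=
  forall Y : completeNormedModType R, (Y -> Y) -> Y -> nat -> Y.

Definition preserves_quadratic_invariants (Phi : integrator) : Prop :=
  forall Y Z (f : Y -> Y) (F : Y -> Z), smooth f -> quadratic F ->
    (forall y, 'd F y (f y) = 0) ->
    forall y, series_comp F (Phi Y f y) = cst_series (F y).

Definition functionally_equivariant
    (P : forall Y Z, (Y -> Z) -> Prop) (Phi : integrator) : Prop :=
  forall Y Z (f : Y -> Y) (F : Y -> Z), smooth f -> P Y Z F ->
    let g (p : Y * Z) := (f p.1, 'd F (p.1) (f p.1)) in
    forall y, series_comp (fun x => (x, F x)) (Phi Y f y)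
              = Phi (Y * Z)%type g (y, F y).

(* Since the derivatives of a smooth map are symmetric, the value does not
   depend on the order of the children. *)
Fixpoint elementary_differential Y (f : Y -> Y) (t : ptree) (y : Y) : Y :=
  let: Node ts := t in
  nderiv f (map (fun s => elementary_differential f s y) ts) y.

Definition bseries (a : rtree -> R) : integrator := fun Y f y n =>
  if n == 0%N then y else
  \sum_(t \in trees_of_order n)
    (a t / (symmetry t)%:R) *: elementary_differential f t y.

(* The B-series of the exact time-one flow of c f; c = 0 gives the identity.
   These maps satisfy every functional equivariance. *)
Definition exact_flow (c : R) : rtree -> R :=
  fun t => c ^+ nb_vertices t / (tree_factorial t)%:R.

End Maps.

(* Main.v *)
(** (a) and (b): elementary differentials commute with linear semiconjugacies.
    Let g be the augmented field on Y * Z.  If F(y) = F(0) + L y, the linear map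
    (y, z) |-> z - L y semiconjugates g to the zero field; if F is quadratic,
    (y, z) |-> z - F(y) is a quadratic invariant of g.  Either way the method
    keeps z - F(y) constant along the augmented step started at (y, F(y)).

    (c): on the space with one coordinate y_t for each tree t of order at most n,
    the field f_t(y) = prod of the y_s over the children s of t satisfies
    D_f(tau)_t(0) = sigma(tau) [tau = t].  Equivariance under the monomial
    F(y) = prod of the y_u, u in us, with at most three factors, then reads
      prod_u a(u) = sum_u a(u with the other trees of us grafted onto its root).
    The rules for two and three trees imply those for any number of trees, and
    the latter determine a from a(leaf), by induction on the order and then
    downwards on the degree of the root.  Since c^|t| / gamma(t) satisfies the
    same rules, a is the exact flow with c = a(leaf). *)

From HB Require Import structures.
From mathcomp Require Import all_boot all_order all_algebra finmap.
From mathcomp Require Import all_classical all_reals all_analysis.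
From mathcomp Require Import ring zify.
Require Import Defs.

Set Implicit Arguments.
Unset Strict Implicit.
Unset Printing Implicit Defensive.
Import Order.TTheory GRing.Theory Num.Theory.
Import numFieldNormedType.Exports.
Local Open Scope classical_set_scope.
Local Open Scope ring_scope.

(** * Higher derivatives *)

Section SeqDerivatives.
Context {R : realType}.
Implicit Types X Y Z W : completeNormedModType R.

Local Notation prodn vs := (\prod_(v <- vs) `|v|).

(* [derivatives] with lists of directions instead of tuples, so that directions
   can be inserted and deleted without casts. *)
Definition sderivs Y Z (f : Y -> Z) (E : Y -> seq Y -> Z) :=
  [/\ forall y, E y [::] = f y,
      forall y p q (c : R) u v, E y (p ++ (c *: u + v) :: q)
        = c *: E y (p ++ u :: q) + E y (p ++ v :: q),
      forall y k, exists2 C : R, 0 <= C &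
        forall vs, size vs = k -> `|E y vs| <= C * prodn vs &
      forall y k (e : R), 0 < e -> \forall h \near (0 : Y),
        forall vs, size vs = k ->
        `|E (y + h) vs - E y vs - E y (h :: vs)| <= e * `|h| * prodn vs].

Definition linear_of Y Z (f : Y -> Z) (fl : linear f) : {linear Y -> Z} :=
  HB.pack_for {linear Y -> Z} f (GRing.isLinear.Build R Y Z *:%R f fl).

Lemma prodn_ge0 Y (vs : seq Y) : 0 <= prodn vs.
Proof. by apply: prodr_ge0. Qed.

Lemma val_tuple_subst T k (i : 'I_k) (vs : k.-tuple T) w :
  [tuple if j == i then w else tnth vs j | j < k]
    = take i vs ++ w :: drop i.+1 vs :> seq T.
Proof.
have sz : size (take i vs ++ w :: drop i.+1 vs) = k.
  rewrite size_cat /= size_take size_drop size_tuple ltn_ord.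
  by rewrite addnS -addSn subnKC.
apply: (@eq_from_nth _ w); first by rewrite size_tuple sz.
rewrite size_tuple => j jk; rewrite -(tnth_nth _ _ (Ordinal jk)) tnth_mktuple.
rewrite nth_cat size_take size_tuple ltn_ord -val_eqE /=.
case: ltngtP => ij; first by rewrite nth_take // (tnth_nth w).
  rewrite -subnSK //= nth_drop (tnth_nth w) /=.
  by rewrite addSn -addnS subnSK // subnKC // ltnW.
by rewrite ij subnn.
Qed.

Lemma bounded_multilinear_seq Y Z k (E : seq Y -> Z) :
  (forall p q (c : R) u v, E (p ++ (c *: u + v) :: q)
    = c *: E (p ++ u :: q) + E (p ++ v :: q)) ->
  (exists C : R, forall vs, size vs = k -> `|E vs| <= C * prodn vs) ->
  bounded_multilinear (fun vs : k.-tuple Y => E vs).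
Proof.
move=> El [C EC]; split; last by exists C => vs; rewrite EC ?size_tuple.
by move=> i vs c u v /=; rewrite !val_tuple_subst; exact: El.
Qed.

(** Multilinearity phrased through the underlying lists, so that it applies to concrete tuples such
    as [[tuple u; v]] without casting them to the substitution form of [bounded_multilinear]. *)
Lemma bounded_multilinear_slot Y Z k (M : k.-tuple Y -> Z) :
  bounded_multilinear M -> forall (s1 s2 s3 : k.-tuple Y) p q c u v,
  s1 = p ++ (c *: u + v) :: q :> seq Y -> s2 = p ++ u :: q :> seq Y ->
  s3 = p ++ v :: q :> seq Y -> M s1 = c *: M s2 + M s3.
Proof.
move=> [Ml _] s1 s2 s3 p q c u v s1E s2E s3E.
have pk : (size p < k)%N by rewrite -(size_tuple s2) s2E size_cat /= -addSnnS leq_addr.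
have substE (s : k.-tuple Y) w : s = p ++ w :: q :> seq Y ->
    s = [tuple if j == Ordinal pk then w else tnth s2 j | j < k].
  move=> sE; apply: val_inj; rewrite /= val_tuple_subst /= s2E sE take_size_cat //.
  by rewrite -(cat_rcons u) drop_size_cat ?size_rcons.
have /= := Ml (Ordinal pk) s2 c u v.
by rewrite -(substE _ _ s1E) -(substE _ _ s2E) -(substE _ _ s3E).
Qed.

Lemma sderivs_derivatives Y Z (f : Y -> Z) E :
  sderivs f E -> derivatives f (fun k y (vs : k.-tuple Y) => E y vs).
Proof.
move=> [E0 Elin Ebnd Ed]; split.
- by move=> y vs; rewrite tuple0 -E0.
- move=> k y; apply: bounded_multilinear_seq; first exact: Elin.
  by have [C _ HC] := Ebnd y k; exists C.
- move=> k y e /(Ed y k); apply: filterS => h Hh vs; apply: Hh.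
  by rewrite size_tuple.
Qed.

Lemma smooth_sderivs Y Z (f : Y -> Z) :
  smooth f -> sderivs f (fun y vs => nderiv f vs y).
Proof.
move=> [D Df]; have [D0 Dml Dd] := Df.
have DE y k (vs : k.-tuple Y) : nderiv f vs y = D _ y vs.
  by rewrite -(nderivE Df).
split.
- by [].
- move=> y p q c u v.
  have sz w : size (p ++ w :: q) == (size p + (size q).+1)%N by rewrite size_cat.
  rewrite (DE _ _ (Tuple (sz (c *: u + v)))) (DE _ _ (Tuple (sz u))) (DE _ _ (Tuple (sz v))).
  exact: (bounded_multilinear_slot (Dml _ y)).
- move=> y k; have [_ [C HC]] := Dml k y; exists `|C| => // vs sz.
  move/eqP: sz => sz; rewrite (DE y k (Tuple sz)) (le_trans (HC _)) //=.
  by rewrite ler_wpM2r ?prodn_ge0 ?ler_norm.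
- move=> y k e /(Dd k y); apply: filterS => h Hh vs /eqP sz.
  by have := Hh (Tuple sz); rewrite -!DE.
Qed.

Lemma sderivs_smooth Y Z (f : Y -> Z) E : sderivs f E -> smooth f.
Proof. by move/sderivs_derivatives => Df; eexists; exact: Df. Qed.

(** Derivatives are unique, so any family meeting the conditions of [sderivs] computes [nderiv].
    Explicit derivatives are obtained this way below. *)
Lemma nderiv_sderivs Y Z (f : Y -> Z) E : sderivs f E ->
  forall vs y, nderiv f vs y = E y vs.
Proof.
move=> /sderivs_derivatives Df vs y.
by rewrite (nderivE Df (in_tuple vs)).
Qed.

Lemma sderivs_cst Y Z (z : Z) :
  sderivs (fun _ : Y => z) (fun _ vs => if vs is [::] then z else 0).
Proof.
split=> //.
- by move=> _ [|? ?] q c u v /=; rewrite scaler0 addr0.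
- move=> y k; exists `|z| => // -[|v vs] _; first by rewrite big_nil mulr1.
  by rewrite normr0 mulr_ge0 ?prodn_ge0.
- move=> y k e e0; apply: nearW => h vs _.
  have -> : (if vs is [::] then z else 0) - (if vs is [::] then z else 0) - 0 = 0 :> Z.
    by rewrite subrr subr0.
  by rewrite normr0 !mulr_ge0 ?prodn_ge0 ?(ltW e0).
Qed.

Lemma sderivs_id Y : sderivs (@id Y)
  (fun y vs => match vs with [::] => y | [:: v] => v | _ => 0 end).
Proof.
split=> //.
- by move=> y [|? [|? ?]] [|? ?] c u v //=; rewrite scaler0 addr0.
- move=> y k; exists (`|y| + 1) => [|[|v [|w vs]] _]; first by rewrite addr_ge0.
  + by rewrite big_nil mulr1 lerDl.
  + by rewrite big_seq1 ler_peMl // lerDr.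
  + by rewrite normr0 mulr_ge0 ?prodn_ge0 // addr_ge0.
- move=> y k e e0; apply: nearW => h [|v [|w vs]] _;
  by rewrite ?(addrC y) ?addrK ?subrr ?subr0 ?subrr ?normr0 !mulr_ge0 ?prodn_ge0 ?(ltW e0).
Qed.

Lemma sderivsD Y Z (f1 f2 : Y -> Z) E1 E2 : sderivs f1 E1 -> sderivs f2 E2 ->
  sderivs (fun y => f1 y + f2 y) (fun y vs => E1 y vs + E2 y vs).
Proof.
move=> [E10 E1l E1b E1d] [E20 E2l E2b E2d]; split.
- by move=> y; rewrite E10 E20.
- by move=> y p q c u v; rewrite E1l E2l scalerDr addrACA.
- move=> y k; have [C1 C10 H1] := E1b y k; have [C2 C20 H2] := E2b y k.
  exists (C1 + C2) => [|vs sz]; first exact: addr_ge0.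
  by rewrite (le_trans (ler_normD _ _)) // mulrDl lerD ?H1 ?H2.
- move=> y k e e0; have e20 : 0 < e / 2 by rewrite divr_gt0.
  apply: filterS2 (E1d y k _ e20) (E2d y k _ e20) => h H1 H2 vs sz.
  have -> : E1 (y + h) vs + E2 (y + h) vs - (E1 y vs + E2 y vs)
      - (E1 y (h :: vs) + E2 y (h :: vs))
    = (E1 (y + h) vs - E1 y vs - E1 y (h :: vs))
      + (E2 (y + h) vs - E2 y vs - E2 y (h :: vs)).
    by rewrite !opprD (addrACA (E1 _ _)) (addrACA (E1 (y + h) vs - _)).
  rewrite (le_trans (ler_normD _ _)) // (le_trans (lerD (H1 _ sz) (H2 _ sz))) //.
  by rewrite -2!mulrDl -splitr.
Qed.

Lemma sderivs_linl Y Z W (L : {linear Z -> W}) (C : R) (f : Y -> Z) E :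
  (forall z, `|L z| <= C * `|z|) -> sderivs f E ->
  sderivs (fun y => L (f y)) (fun y vs => L (E y vs)).
Proof.
move=> LC [E0 El Eb Ed].
have LC' z : `|L z| <= `|C| * `|z|.
  by rewrite (le_trans (LC z)) // ler_wpM2r // ler_norm.
split.
- by move=> y; rewrite E0.
- by move=> y p q c u v; rewrite El linearP.
- move=> y k; have [D D0 H] := Eb y k; exists (`|C| * D) => [|vs sz].
    exact: mulr_ge0.
  by rewrite (le_trans (LC' _)) // -mulrA ler_wpM2l // H.
- move=> y k e e0; have C1 : 0 < `|C| + 1 by rewrite ltr_wpDl.
  have e20 : 0 < e / (`|C| + 1) by rewrite divr_gt0.
  apply: filterS (Ed y k _ e20) => h H vs sz.
  rewrite -!linearB (le_trans (LC' _)) //.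
  rewrite (le_trans (ler_wpM2l _ (H _ sz))) // !mulrA.
  do 2 (rewrite ler_wpM2r ?prodn_ge0 //).
  by rewrite ler_pdivrMr // mulrC ler_wpM2l ?(ltW e0) // lerDl.
Qed.

Lemma sderivs_linr X Y Z (L : {linear X -> Y}) (C : R) (f : Y -> Z) E :
  (forall x, `|L x| <= C * `|x|) -> sderivs f E ->
  sderivs (fun x => f (L x)) (fun x vs => E (L x) (map L vs)).
Proof.
move=> LC [E0 El Eb Ed].
pose C' := `|C| + 1; have C'0 : 0 < C' by rewrite ltr_wpDl.
have LC' x : `|L x| <= C' * `|x|.
  by rewrite (le_trans (LC x)) // ler_wpM2r // ler_wpDr ?ler_norm.
have Lprod vs : prodn (map L vs) <= C' ^+ size vs * prodn vs.
  elim: vs => [|v vs IH] /=; first by rewrite !big_nil mulr1.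
  rewrite !big_cons exprS mulrACA ler_pM // prodn_ge0 //.
split.
- by move=> x; rewrite E0.
- by move=> y p q c u v; rewrite !map_cat /= linearP El.
- move=> x k; have [D D0 H] := Eb (L x) k; exists (D * C' ^+ k) => [|vs sz].
    by rewrite mulr_ge0 ?exprn_ge0 ?(ltW C'0).
  rewrite (le_trans (H _ _)) ?size_map // -mulrA ler_wpM2l //.
  by rewrite -sz.
- move=> x k e e0.
  (* One factor [C'] pays for [L h], the other [k] for the images of the directions. *)
  have e20 : 0 < e / C' ^+ k.+1 by rewrite divr_gt0 ?exprn_gt0.
  have Lcont : L h @[h --> (0 : X)] --> (0 : Y).
    rewrite -(linear0 L); apply: bounded_linear_continuous.
    apply/linear_boundedP; near=> r => z.
    by apply: (le_trans (LC' _)); apply: ler_wpM2r.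
  have HL : \forall h \near (0 : X), forall vs, size vs = k ->
    `|E (L x + L h) vs - E (L x) vs - E (L x) (L h :: vs)|
      <= e / C' ^+ k.+1 * `|L h| * prodn vs := Lcont _ (Ed (L x) k _ e20).
  apply: filterS HL => h H vs sz.
  rewrite linearD (le_trans (H _ _)) ?size_map //.
  apply: (@le_trans _ _ (e / C' ^+ k.+1 * (C' * `|h|) * (C' ^+ size vs * prodn vs))).
    apply: ler_pM => //; first by rewrite mulr_ge0 ?(ltW e20).
      exact: prodn_ge0.
    by rewrite ler_wpM2l ?(ltW e20).
  rewrite sz mulrACA mulrA ler_wpM2r ?prodn_ge0 //.
  rewrite exprS.
  have Ck : C' ^+ k != 0 by rewrite expf_neq0 ?gt_eqF.
  suff -> : e / (C' * C' ^+ k) * C' ^+ k * (C' * `|h|) = e * `|h| by [].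
  by field; rewrite Ck gt_eqF.
Unshelve. all: by end_near. Qed.

(** * Leibniz rule for [B y (f y)] with [B] bounded bilinear *)

Section Leibniz.
Variables (Y Z W : completeNormedModType R) (B : Y -> Z -> W).
Hypothesis Bl : forall c y1 y2 z, B (c *: y1 + y2) z = c *: B y1 z + B y2 z.
Hypothesis Br : forall c y z1 z2, B y (c *: z1 + z2) = c *: B y z1 + B y z2.
Variable CB : R.
Hypothesis HB : forall y z, `|B y z| <= CB * (`|y| * `|z|).

(* The sum over the entries v of vs of B v (E (pre ++ vs without v)). *)
Fixpoint leibniz (E : seq Y -> Z) (pre vs : seq Y) : W :=
  if vs is v :: vs' then B v (E (pre ++ vs')) + leibniz E (rcons pre v) vs'
  else 0.

Let BD y z1 z2 : B y (z1 + z2) = B y z1 + B y z2.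
Proof. by have := Br 1 y z1 z2; rewrite !scale1r. Qed.
Let B0 y : B y 0 = 0.
Proof. by apply: (@addIr _ (B y 0)); rewrite -BD !add0r. Qed.
Let BB y z1 z2 : B y (z1 - z2) = B y z1 - B y z2.
Proof. by rewrite addrC -scaleN1r Br scaleN1r addrC. Qed.
Let BDl y1 y2 z : B (y1 + y2) z = B y1 z + B y2 z.
Proof. by have := Bl 1 y1 y2 z; rewrite !scale1r. Qed.

Lemma leibniz_linl (E : seq Y -> Z) p1 p2 c u v vs :
  (forall p q c u v, E (p ++ (c *: u + v) :: q)
        = c *: E (p ++ u :: q) + E (p ++ v :: q)) ->
  leibniz E (p1 ++ (c *: u + v) :: p2) vs
    = c *: leibniz E (p1 ++ u :: p2) vs + leibniz E (p1 ++ v :: p2) vs.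
Proof.
move=> El; elim: vs p2 => [|w vs IH] p2 /=; first by rewrite scaler0 addr0.
rewrite -!catA !cat_cons El Br !rcons_cat !rcons_cons IH.
by rewrite scalerDr addrACA.
Qed.

Lemma leibniz_linr (E : seq Y -> Z) pre p q c u v :
  (forall p q c u v, E (p ++ (c *: u + v) :: q)
        = c *: E (p ++ u :: q) + E (p ++ v :: q)) ->
  leibniz E pre (p ++ (c *: u + v) :: q)
    = c *: leibniz E pre (p ++ u :: q) + leibniz E pre (p ++ v :: q).
Proof.
move=> El; elim: p pre => [|w p IH] pre /=.
  by rewrite Bl -!cats1 leibniz_linl // scalerDr addrACA.
by rewrite !catA El Br IH scalerDr addrACA.
Qed.

Lemma leibniz_bound (E : seq Y -> Z) k (C : R) pre vs : 0 <= C ->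
  (forall vs, size vs = k -> `|E vs| <= C * prodn vs) ->
  (size pre + size vs)%N = k.+1 ->
  `|leibniz E pre vs| <= (size vs)%:R * (`|CB| * C) * prodn (pre ++ vs).
Proof.
move=> C0 EC; elim: vs pre => [|v vs IH] pre /=.
  by rewrite normr0 !mul0r.
rewrite addnS => -[sz]; rewrite (le_trans (ler_normD _ _)) //.
rewrite -cat_rcons mulrSr 2!mulrDl mul1r addrC lerD //.
  by rewrite IH // size_rcons addSn sz.
have -> : prodn (rcons pre v ++ vs) = `|v| * prodn (pre ++ vs).
  by rewrite cat_rcons !big_cat big_cons /= mulrCA.
rewrite (le_trans (HB _ _)) //.
apply: (@le_trans _ _ (`|CB| * (`|v| * `|E (pre ++ vs)|))).
  by rewrite ler_wpM2r ?ler_norm ?mulr_ge0.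
rewrite -mulrA ler_wpM2l // mulrCA ler_wpM2l //.
by rewrite EC // size_cat.
Qed.

Lemma leibnizB (E1 E2 : seq Y -> Z) pre vs :
  leibniz E1 pre vs - leibniz E2 pre vs
    = leibniz (fun ws => E1 ws - E2 ws) pre vs.
Proof.
elim: vs pre => [|v vs IH] pre /=; first by rewrite subrr.
by rewrite BB -IH opprD addrACA.
Qed.

Lemma leibniz_cons (E : seq Y -> Z) h pre vs :
  leibniz E (h :: pre) vs = leibniz (fun ws => E (h :: ws)) pre vs.
Proof.
elim: vs pre => [|v vs IH] pre //=.
by rewrite IH.
Qed.

(** The first argument of [B] is the point itself, whose derivatives vanish beyond order one. So at
    most one direction can fall on it, and the general Leibniz rule keeps only these terms. *)
Lemma sderivs_bilin (f : Y -> Z) E : sderivs f E ->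
  sderivs (fun y => B y (f y)) (fun y vs => B y (E y vs) + leibniz (E y) [::] vs).
Proof.
move=> [E0 El Eb Ed]; split.
- by move=> y; rewrite E0 addr0.
- move=> y p q c u v; rewrite El Br leibniz_linr //.
  by rewrite scalerDr addrACA.
- move=> y k; have [C C0 H] := Eb y k.
  have [C' C'0 H'] := Eb y k.-1.
  exists (`|CB| * `|y| * C + k%:R * (`|CB| * C')) => [|vs sz].
    by rewrite addr_ge0 ?mulr_ge0.
  rewrite (le_trans (ler_normD _ _)) // mulrDl lerD //.
    apply: (@le_trans _ _ (`|CB| * (`|y| * `|E y vs|))).
      by rewrite (le_trans (HB _ _)) // ler_wpM2r ?ler_norm ?mulr_ge0.
    by rewrite -!mulrA !ler_wpM2l // H.
  case: k sz H' {H} => [/size0nil ->|k sz H'].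
    by rewrite normr0 mul0r mul0r.
  by rewrite -sz (leibniz_bound (k := k)).
- move=> y k e e0.
  have [C C0 H] := Eb y k.+1.
  (* [M] collects the constants of the three error terms [b1], [b2], [b3], and the added 1 keeps it
     positive. The number [d] serves both as the radius for [h] and as the tolerance for the
     remainders of [E]. *)
  pose M := `|CB| * (`|y| + 1 + k%:R + C) + 1.
  have M0 : 0 < M by rewrite ltr_wpDl ?mulr_ge0 // !addr_ge0.
  pose d := Num.min (e / M) 1.
  have d0 : 0 < d by rewrite lt_min ltr01 andbT divr_gt0.
  have dge0 := ltW d0.
  have d1 : d <= 1 by rewrite ge_min lexx orbT.
  have dM : d * M <= e by rewrite -ler_pdivlMr // ge_min lexx.
  have near_d : \forall h \near (0 : Y), `|h| <= d.
    by apply: filterS (nbhsx_ballx (0 : Y) _ d0) => h; rewrite -ball_normE /= sub0r normrN => /ltW.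
  apply: filterS3 near_d (Ed y k _ d0) (Ed y k.-1 _ d0) => h hd H1 H2 vs sz.
  (* By bilinearity the error splits into a remainder of order [k], a term where both factors are
     small with [h], and remainders of order [k.-1] inside the Leibniz sum. For [k = 0] the value
     [k.-1] is harmless, since that sum is empty. *)
  have -> : B (y + h) (E (y + h) vs) + leibniz (E (y + h)) [::] vs
      - (B y (E y vs) + leibniz (E y) [::] vs)
      - (B y (E y (h :: vs)) + leibniz (E y) [::] (h :: vs))
    = B y (E (y + h) vs - E y vs - E y (h :: vs))
      + B h (E (y + h) vs - E y vs)
      + leibniz (fun ws => E (y + h) ws - E y ws - E y (h :: ws)) [::] vs.
    rewrite /= leibniz_cons -leibnizB -leibnizB BDl !BB.
    set a := B y _; set b := B h _; set c := leibniz _ _ _; set a' := B y _.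
    set c' := leibniz _ _ _; set a'' := B y _; set b' := B h _; set c'' := leibniz _ _ _.
    rewrite !opprD !addrA.
    rewrite [LHS](AC 8 ((1*4*6)*(2*7)*(3*5*8))%AC).
    by rewrite /= !addrA.
  pose P := prodn vs; have P0 : 0 <= P by exact: prodn_ge0.
  have HBn y' z' (K : R) : `|z'| <= K * P -> `|B y' z'| <= `|CB| * `|y'| * K * P.
    move=> zK; rewrite (le_trans (HB _ _)) // -!mulrA.
    apply: (@le_trans _ _ (`|CB| * (`|y'| * `|z'|))).
      by rewrite ler_wpM2r ?ler_norm ?mulr_ge0.
    by rewrite !ler_wpM2l.
  have b1 : `|B y (E (y + h) vs - E y vs - E y (h :: vs))|
      <= `|CB| * `|y| * (d * `|h|) * P by apply: HBn; exact: H1.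
  have b2 : `|B h (E (y + h) vs - E y vs)| <= `|CB| * `|h| * (d * (1 + C)) * P.
    apply: HBn; rewrite -[E _ _ - _](subrK (E y (h :: vs))).
    rewrite (le_trans (ler_normD _ _)) //.
    have := H (h :: vs); rewrite /= big_cons sz -/P => /(_ erefl) H'.
    rewrite (le_trans (lerD (H1 _ sz) H')) // -/P mulrA -mulrDl ler_wpM2r //.
    rewrite mulrDr mulr1 lerD //.
      by rewrite ler_piMr // ?(ltW d0) // (le_trans hd).
    by rewrite mulrC ler_wpM2r.
  have b3 : `|leibniz (fun ws => E (y + h) ws - E y ws - E y (h :: ws)) [::] vs|
      <= k%:R * (`|CB| * (d * `|h|)) * P.
    have [k0|k0] := posnP k.
      by move: sz; rewrite k0 => /size0nil ->; rewrite /= normr0 !mulr_ge0.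
    rewrite -[in leRHS]sz; apply: (leibniz_bound (k := k.-1)) => //.
      by rewrite mulr_ge0.
    by rewrite add0n sz prednK.
  rewrite (le_trans (ler_normD _ _)) // (le_trans (lerD (ler_normD _ _) b3)) //.
  rewrite (le_trans (lerD (lerD b1 b2) (lexx _))) // -!mulrDl ler_wpM2r //.
  have -> : `|CB| * `|y| * (d * `|h|) + `|CB| * `|h| * (d * (1 + C))
      + k%:R * (`|CB| * (d * `|h|))
    = d * (`|CB| * (`|y| + 1 + k%:R + C)) * `|h| by ring.
  rewrite ler_wpM2r // (le_trans _ dM) // ler_wpM2l ?(ltW d0) //.
  by rewrite lerDl.
Qed.

End Leibniz.
End SeqDerivatives.

(** * Linear semiconjugacies and affine equivariance *)

Section VectorPolynomials.
Context {R : realType} (V : completeNormedModType R).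
Implicit Types (c : nat -> V) (N n : nat).

Definition vpoly N c (t : R) : V := \sum_(k < N) t ^+ k *: c k.

Let dshift c k : V := k.+1%:R *: c k.+1.

Lemma derive1_vpoly N c : derive1 (vpoly N.+1 c) = vpoly N (dshift c).
Proof.
apply/funext => t.
have der_monomial k : is_derive t 1 (fun s : R => s ^+ k *: c k)
    ((k%:R * t ^+ k.-1) *: c k).
  have dX : differentiable (@GRing.exp R ^~ k) t.
    by apply/derivable1_diffP; exact: exprn_derivable.
  apply: DeriveDef; first exact/diff_derivable/differentiableZl.
  rewrite deriveE; last exact: differentiableZl.
  by rewrite diffZl // -deriveE // exp_derive /GRing.scale /= mulr1.
have dvp : is_derive t 1 (vpoly N.+1 c) (\sum_(k < N.+1) (k%:R * t ^+ k.-1) *: c k).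
  rewrite (_ : vpoly N.+1 c = \sum_(k < N.+1) (fun s : R => s ^+ k *: c k)).
    exact: is_derive_sum.
  by apply/funext => s; rewrite fct_sumE.
rewrite derive1E derive_val /vpoly big_ord_recl mul0r scale0r add0r.
by apply: eq_bigr => k _; rewrite /dshift scalerA mulrC.
Qed.

Lemma derive1n_vpoly N c n : (n < N)%N -> derive1n n (vpoly N c) 0 = n`!%:R *: c n.
Proof.
elim: n N c => [|n IH] [|N] c // ltnN.
  rewrite derive1n0 /vpoly big_ord_recl expr0 big1 ?addr0 ?scale1r // => k _.
  by rewrite expr0n scale0r.
rewrite derive1Sn derive1_vpoly IH // /dshift scalerA.
by rewrite factS mulnC natrM.
Qed.

Lemma taylor_vpoly N c n : (n < N)%N ->
  n`!%:R^-1 *: derive1n n (vpoly N c) 0 = c n.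
Proof.
by move=> ?; rewrite derive1n_vpoly // scalerA mulVf ?scale1r // pnatr_eq0 -lt0n fact_gt0.
Qed.

Lemma vpolyD N c d t :
  vpoly N (fun k => c k + d k) t = vpoly N c t + vpoly N d t.
Proof. by rewrite /vpoly -big_split; apply: eq_bigr => k _; rewrite scalerDr. Qed.

Lemma vpolyB N c d t :
  vpoly N (fun k => c k - d k) t = vpoly N c t - vpoly N d t.
Proof. by rewrite /vpoly -sumrB; apply: eq_bigr => k _; rewrite scalerBr. Qed.

Lemma vpoly_cst (v : V) n t : vpoly n.+1 (cst_series v) t = v.
Proof.
rewrite /vpoly big_ord_recl expr0 scale1r big1 ?addr0 // => k _.
by rewrite scaler0.
Qed.

Lemma vpolyW N M c t : (N <= M)%N ->
  vpoly N c t = vpoly M (fun k => if (k < N)%N then c k else 0) t.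
Proof.
move=> leNM; rewrite /vpoly (big_ord_widen M (fun k => t ^+ k *: c k) leNM).
by rewrite big_mkcond; apply: eq_bigr => k _; case: ifP; rewrite ?scaler0.
Qed.

End VectorPolynomials.

(** * Elementary differentials and B-series under bounded linear maps *)

Section Maps.
Context {R : realType}.
Implicit Types X Y Z W : completeNormedModType R.

Lemma continuous_linear_norm Y Z (L : {linear Y -> Z}) : continuous L ->
  exists2 C : R, 0 <= C & forall y, `|L y| <= C * `|y|.
Proof.
move=> /linear_bounded_continuous/linear_boundedP/pinfty_ex_gt0[C C0 LC].
by exists C => //; exact: ltW.
Qed.

Lemma fst_norm Y Z (p : Y * Z) : `|p.1| <= 1 * `|p|.
Proof. by rewrite mul1r prod_normE le_max lexx. Qed.

Lemma snd_norm Y Z (p : Y * Z) : `|p.2| <= 1 * `|p|.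
Proof. by rewrite mul1r prod_normE le_max lexx orbT. Qed.

Lemma sderivs_pair X Y Z (f1 : X -> Y) (f2 : X -> Z) E1 E2 :
  sderivs f1 E1 -> sderivs f2 E2 ->
  sderivs (fun x => (f1 x, f2 x) : (Y * Z)%type) (fun x vs => (E1 x vs, E2 x vs)).
Proof.
move=> [E10 E1l E1b E1d] [E20 E2l E2b E2d]; split.
- by move=> y; rewrite E10 E20.
- by move=> y p q c u v; rewrite E1l E2l.
- move=> y k; have [C1 C10 H1] := E1b y k; have [C2 C20 H2] := E2b y k.
  exists (Num.max C1 C2) => [|vs sz]; first by rewrite le_max C10.
  rewrite prod_normE ge_max /= (le_trans (H1 _ sz)) ?(le_trans (H2 _ sz)) //;
  by rewrite ler_wpM2r ?prodn_ge0 // le_max lexx ?orbT.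
- move=> y k e e0; apply: filterS2 (E1d y k _ e0) (E2d y k _ e0) => h H1 H2 vs sz.
  by rewrite prod_normE ge_max /= H1 ?H2.
Qed.

(** Differentiating the semiconjugacy relation shows that [L] carries each derivative of [f] at [x]
    to the derivative of [g] at [L x] along the mapped directions. Induction on the tree does the
    rest. *)
Lemma elementary_differential_linear X Y (f : X -> X) (g : Y -> Y)
    (L : {linear X -> Y}) (C : R) :
  (forall x, `|L x| <= C * `|x|) -> smooth f -> smooth g ->
  (forall x, L (f x) = g (L x)) -> forall t x,
  L (elementary_differential f t x) = elementary_differential g t (L x).
Proof.
move=> LC sf sg fg t x.
have Lnd vs : L (nderiv f vs x) = nderiv g (map L vs) (L x).
  rewrite -(nderiv_sderivs (sderivs_linl LC (smooth_sderivs sf))).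
  rewrite -(nderiv_sderivs (sderivs_linr LC (smooth_sderivs sg))).
  by congr (nderiv _ vs x); apply/funext => z; rewrite fg.
elim/ptree_all_ind: t => ts IH /=; rewrite Lnd -map_comp; congr (nderiv g _ _).
by elim: ts IH => //= s ts IHts [-> /IHts ->].
Qed.

Lemma elementary_differential0 Y t (y : Y) :
  elementary_differential (fun _ : Y => 0) t y = 0.
Proof.
case: t => ts /=; rewrite (nderiv_sderivs (sderivs_cst Y 0)).
by case: map.
Qed.

Lemma bseries0 (a : rtree -> R) Y (y : Y) : bseries a (fun _ : Y => 0) y = cst_series y.
Proof.
apply/funext => n; rewrite /bseries /cst_series; case: eqP => // _.
by rewrite fsbig1 // => t _; rewrite elementary_differential0 scaler0.
Qed.

Lemma bseries_finE (a : rtree -> R) Y (f : Y -> Y) y n : n != 0%N ->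
  bseries a f y n = \sum_(t <- fset_set (trees_of_order n))
    (a t / (symmetry t)%:R) *: elementary_differential f t y.
Proof.
by rewrite /bseries => /negPf ->; rewrite fsbig_finite //; exact: finite_trees_of_order.
Qed.

Lemma linear_bseries (a : rtree -> R) X Y (f : X -> X) (L : {linear X -> Y}) x n :
  n != 0%N -> L (bseries a f x n) = \sum_(t <- fset_set (trees_of_order n))
    (a t / (symmetry t)%:R) *: L (elementary_differential f t x).
Proof.
move=> n0; rewrite bseries_finE // linear_sum.
by apply: eq_bigr => t _; rewrite linearZ.
Qed.

Lemma bseries_linear (a : rtree -> R) X Y (f : X -> X) (g : Y -> Y)
    (L : {linear X -> Y}) (C : R) :
  (forall x, `|L x| <= C * `|x|) -> smooth f -> smooth g ->
  (forall x, L (f x) = g (L x)) -> forall x n,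
  L (bseries a f x n) = bseries a g (L x) n.
Proof.
move=> LC sf sg fg x n; have [->|n0] := eqVneq n 0%N; first by [].
rewrite linear_bseries // bseries_finE //; apply: eq_bigr => t _.
by rewrite (elementary_differential_linear LC sf sg fg).
Qed.

(** The projection to the first component is a linear semiconjugacy from [g] to [f]. *)
Lemma bseries_fst (a : rtree -> R) Y Z (f : Y -> Y) (g : Y * Z -> Y * Z) p n :
  smooth f -> smooth g -> (forall p, (g p).1 = f p.1) ->
  (bseries a g p n).1 = bseries a f p.1 n.
Proof.
move=> sf sg gf.
exact: (@bseries_linear a (Y * Z)%type Y g f fst _ (@fst_norm Y Z) sg sf gf p n).
Qed.

(** The way to evaluate [series_comp]: once [F] along the truncated series is known as a polynomial
    in time, the coefficient is read off. [N] is free above [n] because a nonlinear [F] raises the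
    degree. *)
Lemma series_comp_vpoly Y Z (F : Y -> Z) (u : nat -> Y) n N c : (n < N)%N ->
  (forall t, F (vpoly n.+1 u t) = vpoly N c t) -> series_comp F u n = c n.
Proof.
move=> nN Fu; rewrite /series_comp -[RHS](taylor_vpoly c nN); congr (_ *: derive1n n _ _).
exact/funext.
Qed.

Lemma vpoly_linear Y Z (L : {linear Y -> Z}) N c t :
  L (vpoly N c t) = vpoly N (L \o c) t.
Proof. by rewrite /vpoly linear_sum; apply: eq_bigr => k _; rewrite linearZ. Qed.

Lemma vpoly_pair Y Z N (c : nat -> Y) (d : nat -> Z) t :
  vpoly N (fun k => (c k, d k) : (Y * Z)%type) t = (vpoly N c t, vpoly N d t).
Proof.
set v := vpoly N _ t; rewrite [LHS]surjective_pairing; congr pair.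
  exact: (@vpoly_linear (Y * Z)%type Y fst).
exact: (@vpoly_linear (Y * Z)%type Z snd).
Qed.

End Maps.

(** * Affine equivariance of every B-series *)

Section AffineEquivariance.
Context {R : realType}.

Lemma affine_equivariance (a : rtree -> R) :
  functionally_equivariant (@affine R) (bseries a).
Proof.
move=> Y Z f F sf [L [cL FL]] g y.
have [C C0 LC] := continuous_linear_norm cL.
(* Transport along [funext FL] gives [F] the derivatives of [F 0 + L]. *)
have sF : sderivs F _ := eq_ind_r (fun F' => sderivs F' _)
  (sderivsD (sderivs_cst Y (F 0)) (sderivs_linl LC (sderivs_id Y))) (funext FL).
have dF x h : 'd F x h = L h.
  by have /= -> := nderiv_sderivs sF [:: h] x; rewrite add0r.
have gE p : g p = (f p.1, L (f p.1)) by rewrite /g dF.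
have sg : smooth g.
  rewrite (funext gE).
  have s1 := sderivs_linr (@fst_norm R Y Z) (smooth_sderivs sf).
  by apply: sderivs_smooth; apply: (sderivs_pair s1 (sderivs_linl LC s1)).
have g1 n p : (bseries a g p n).1 = bseries a f p.1 n.
  by apply: bseries_fst => // q; rewrite gE.
apply/funext => n.
pose G : {linear (Y * Z)%type -> Z} := snd \- (L \o fst).
have GC p : `|G p| <= (1 + C) * `|p|.
  rewrite (le_trans (ler_normB _ _)) // mulrDl lerD ?snd_norm //=.
  by rewrite (le_trans (LC _)) // ler_wpM2l // -[leRHS]mul1r fst_norm.
(* [G] sends the starting point to [F 0], and the B-series of the zero field stays there. *)
have w2 : (bseries a g (y, F y) n).2
    = L (bseries a g (y, F y) n).1 + cst_series (F 0) n.
  have := @bseries_linear R a _ _ g (fun=> 0) G _ GC sg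
    (sderivs_smooth (sderivs_cst _ 0)) (fun p => _) (y, F y) n.
  rewrite bseries0 /G /= FL addrK => <-; first by rewrite [RHS]addrC subrK.
  by move=> p; rewrite dF subrr.
rewrite (series_comp_vpoly (c := fun k => (bseries a f y k,
    L (bseries a f y k) + cst_series (F 0) k)) (ltnSn n)).
  by rewrite [RHS]surjective_pairing w2 !g1.
move=> t; rewrite vpoly_pair FL vpoly_linear addrC; congr pair.
by rewrite vpolyD vpoly_cst.
Qed.

End AffineEquivariance.

(** * Quadratic equivariance *)

Section QuadraticMaps.
Context {R : realType}.
Implicit Types Y Z W : completeNormedModType R.

(** The homogeneous parts of a quadratic map, unbundled from tuples. [m2] is not assumed symmetric,
    hence the two bilinear terms in [quadratic_form_diff]. *)
Definition quadratic_form Y Z (m0 : Z) (m1 : {linear Y -> Z}) (m2 : Y -> Y -> Z)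
    (F : Y -> Z) :=
  [/\ exists2 C : R, 0 <= C & forall y, `|m1 y| <= C * `|y|,
      forall c u1 u2 v, m2 (c *: u1 + u2) v = c *: m2 u1 v + m2 u2 v,
      forall c u v1 v2, m2 u (c *: v1 + v2) = c *: m2 u v1 + m2 u v2,
      exists2 C : R, 0 <= C & forall u v, `|m2 u v| <= C * (`|u| * `|v|) &
      forall y, F y = m0 + (m1 y + m2 y y)].

Lemma quadratic_formP Y Z (F : Y -> Z) : quadratic F ->
  exists m0 (m1 : {linear Y -> Z}) m2, quadratic_form m0 m1 m2 F.
Proof.
move=> [M [Mml FM]].
pose m1 y := M 1 [tuple y]; pose m2 u v := M 2 [tuple u; v].
have m1l : linear m1.
  by move=> c u v; apply: (bounded_multilinear_slot (Mml 1%N) (p := [::]) (q := [::])).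
exists (M 0 [tuple]), (linear_of m1l), m2.
split.
- have [_ [C HC]] := Mml 1%N; exists `|C| => // y /=.
  rewrite (le_trans (HC _)) //= big_seq1 ler_wpM2r // ler_norm //.
- by move=> c u1 u2 v; apply: (bounded_multilinear_slot (Mml 2) (p := [::]) (q := [:: v])).
- by move=> c u v1 v2; apply: (bounded_multilinear_slot (Mml 2) (p := [:: u]) (q := [::])).
- have [_ [C HC]] := Mml 2; exists `|C| => // u v.
  rewrite (le_trans (HC _)) //= big_cons big_seq1 ler_wpM2r ?mulr_ge0 ?ler_norm //.
- move=> y; rewrite FM !big_ord_recl big_ord0 addr0 /=.
  by congr (M 0 _ + (M 1 _ + M 2 _)); exact: val_inj.
Qed.

Lemma quadratic_form_quadratic Y Z m0 m1 m2 (F : Y -> Z) :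
  quadratic_form m0 m1 m2 F -> quadratic F.
Proof.
move=> [[C1 C10 m1C] m2l m2r [C2 C20 m2C] FE].
pose M (vs : seq Y) := match vs with
  | [::] => m0 | [:: u] => m1 u | [:: u; v] => m2 u v | _ => 0 end.
exists (fun k vs => M vs); split.
- move=> k; apply: bounded_multilinear_seq.
    move=> [|? [|? [|? ?]]] [|? [|? ?]] c u v //=; rewrite ?linearP ?scaler0 ?addr0 //.
  exists (`|m0| + C1 + C2) => -[|u [|v [|w vs]]] _ /=.
  + by rewrite big_nil mulr1 -addrA lerDl addr_ge0.
  + by rewrite big_seq1 (le_trans (m1C _)) // ler_wpM2r // addrAC lerDr addr_ge0.
  + by rewrite big_cons big_seq1 (le_trans (m2C _ _)) // ler_wpM2r ?mulr_ge0 // lerDr addr_ge0.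
  + by rewrite normr0 mulr_ge0 ?prodn_ge0 ?addr_ge0.
- by move=> y; rewrite FE !big_ord_recl big_ord0 addr0.
Qed.

Lemma quadratic_form_diff Y Z m0 m1 m2 (F : Y -> Z) :
  quadratic_form m0 m1 m2 F -> forall y h, 'd F y h = m1 h + (m2 y h + m2 h y).
Proof.
move=> [[C1 _ m1C] m2l m2r [C2 _ m2C] /funext FE] y h.
have sF := sderivsD (sderivs_cst Y m0) (sderivsD (sderivs_linl m1C (sderivs_id Y))
  (sderivs_bilin m2l m2r m2C (sderivs_id Y))).
by have /= := nderiv_sderivs sF [:: h] y; rewrite -FE add0r addr0 => ->.
Qed.

(** The coefficients [e] are those of the Cauchy product; [N + N] leaves room for every degree
    [i + j]. *)
Lemma vpoly_bilin Y Z (m2 : Y -> Y -> Z) N (c d : nat -> Y) :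
  (forall c u1 u2 v, m2 (c *: u1 + u2) v = c *: m2 u1 v + m2 u2 v) ->
  (forall c u v1 v2, m2 u (c *: v1 + v2) = c *: m2 u v1 + m2 u v2) ->
  exists e, forall t, m2 (vpoly N c t) (vpoly N d t) = vpoly (N + N) e t.
Proof.
move=> m2l m2r.
exists (fun k => \sum_(i < N) \sum_(j < N) if (i + j == k)%N then m2 (c i) (d j) else 0) => t.
have m2D0 v : m2 0 v = 0.
  by apply: (@addIr _ (m2 0 v)); rewrite add0r -[X in X + _]scale1r -m2l scale1r addr0.
have m20D u : m2 u 0 = 0.
  by apply: (@addIr _ (m2 u 0)); rewrite add0r -[X in X + _]scale1r -m2r scale1r addr0.
have m2Dl v : {morph m2^~ v : x y / x + y}.
  by move=> x y; rewrite -[x in LHS]scale1r m2l scale1r.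
have m2Dr u : {morph m2 u : x y / x + y}.
  by move=> x y; rewrite -[x in LHS]scale1r m2r scale1r.
have m2Zl r u v : m2 (r *: u) v = r *: m2 u v by rewrite -[r *: u]addr0 m2l m2D0 addr0.
have m2Zr r u v : m2 u (r *: v) = r *: m2 u v by rewrite -[r *: v]addr0 m2r m20D addr0.
transitivity (\sum_(i < N) \sum_(j < N) t ^+ (i + j) *: m2 (c i) (d j)).
  rewrite /vpoly (big_morph _ (m2Dl _) (m2D0 _)); apply: eq_bigr => i _.
  rewrite (big_morph _ (m2Dr _) (m20D _)); apply: eq_bigr => j _.
  by rewrite m2Zl m2Zr scalerA exprD.
rewrite /vpoly; under [RHS]eq_bigr do rewrite scaler_sumr.
rewrite [RHS]exchange_big; apply: eq_bigr => i _ /=.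
under [RHS]eq_bigr do rewrite scaler_sumr.
rewrite [RHS]exchange_big; apply: eq_bigr => j _ /=.
have ijN : (i + j < N + N)%N by rewrite -addnS leq_add // ltnW.
rewrite (bigD1 (Ordinal ijN)) //= eqxx big1 ?addr0 // => k.
by rewrite -val_eqE /= eq_sym => /negPf ->; rewrite scaler0.
Qed.

Lemma quadratic_vpoly Y Z (F : Y -> Z) n (u : nat -> Y) : quadratic F ->
  exists N d, (n < N)%N /\ forall t, F (vpoly n.+1 u t) = vpoly N d t.
Proof.
move=> /quadratic_formP[m0 [m1 [m2 [_ m2l m2r _ FE]]]].
have [e m2e] := @vpoly_bilin _ _ m2 n.+1 u u m2l m2r.
exists (n.+1 + n.+1)%N, (fun k => cst_series m0 k +
  ((if (k < n.+1)%N then m1 (u k) else 0) + e k)).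
split=> [|t]; first by rewrite addSn ltnS leq_addr.
rewrite FE m2e vpoly_linear 2!vpolyD addSn vpoly_cst; congr (_ + (_ + _)).
by apply: vpolyW; rewrite ltnS leq_addr.
Qed.

Lemma quadratic_equivariance (a : rtree -> R) :
  preserves_quadratic_invariants (bseries a) ->
  functionally_equivariant (@quadratic R) (bseries a).
Proof.
move=> inv Y Z f F sf qF g y.
have [m0 [m1 [m2 qf]]] := quadratic_formP qF.
have [[C1 C10 m1C] m2l m2r [C2 C20 m2C] FE] := qf.
have dF := quadratic_form_diff qf.
have gE p : g p = (f p.1, m1 (f p.1) + (m2 p.1 (f p.1) + m2 (f p.1) p.1)).
  by rewrite /g dF.
have sg : smooth g.
  rewrite (funext gE).
  (* The value of [f] occurs in either slot of [m2], so the Leibniz rule is used for [m2] and for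
     its transpose. *)
  have m2C' u v : `|m2 v u| <= C2 * (`|u| * `|v|) by rewrite (mulrC `|u|).
  have m2l' c u1 u2 v := m2r c v u1 u2.
  have m2r' c u v1 v2 := m2l c v1 v2 u.
  have s := smooth_sderivs sf.
  have s2 := sderivsD (sderivs_linl m1C s) (sderivsD (sderivs_bilin m2l m2r m2C s)
    (@sderivs_bilin _ _ _ _ (fun u v => m2 v u) m2l' m2r' _ m2C' _ _ s)).
  have s3 := sderivs_linr (@fst_norm R Y Z) s2.
  by apply: sderivs_smooth; apply: (sderivs_pair (sderivs_linr (@fst_norm R Y Z) s) s3).
pose G (p : Y * Z) := p.2 - F p.1.
pose n1 : {linear (Y * Z)%type -> Z} := snd \- (m1 \o fst).
have qG : quadratic_form (- m0) n1 (fun p q => - m2 p.1 q.1) G.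
  split.
  - exists (1 + C1) => [|p]; first exact: addr_ge0.
    rewrite (le_trans (ler_normB _ _)) // mulrDl lerD ?snd_norm //=.
    by rewrite (le_trans (m1C _)) // ler_wpM2l // -[leRHS]mul1r fst_norm.
  - by move=> c u1 u2 v /=; rewrite m2l opprD scalerN.
  - by move=> c u v1 v2 /=; rewrite m2r opprD scalerN.
  - exists C2 => // u v; rewrite normrN (le_trans (m2C _ _)) // ler_wpM2l //.
    by rewrite ler_pM // -[leRHS]mul1r fst_norm.
  - move=> p; rewrite /G FE /n1 /= !opprD addrCA; congr (_ + _); exact: addrA.
have dG p : 'd G p (g p) = 0.
  rewrite (quadratic_form_diff qG) gE /n1 /=.
  by rewrite -opprD addrAC addrK subrr.
pose w := bseries a g (y, F y).
have w1 : (fun k => (w k).1) = bseries a f y.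
  by apply/funext => k; apply: bseries_fst => // q; rewrite gE.
have Gw : series_comp G w = cst_series 0.
  by rewrite (inv _ _ g G sg (quadratic_form_quadratic qG) dG) /G subrr.
apply/funext => n.
(* Truncating [w] after order [n] does not truncate [F] along it: [d] may have higher degree, which
   is why the truncated series are padded with zeros below. *)
have [N [d [nN Fd]]] := quadratic_vpoly n (fun k => (w k).1) qF.
have wV t : vpoly n.+1 w t = (vpoly n.+1 (fun k => (w k).1) t, vpoly n.+1 (fun k => (w k).2) t).
  by rewrite -vpoly_pair; congr (vpoly _ _ t); apply/funext => k; exact: surjective_pairing.
have w2 : (w n).2 = d n.
  apply/eqP; rewrite -subr_eq0; apply/eqP.
  (* [G] vanishes at the starting point, so its constant series is zero at order 0 as well. *)
  transitivity (series_comp G w n); last by rewrite Gw /cst_series; case: ifP.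
  rewrite (series_comp_vpoly (c := fun k => (if (k < n.+1)%N then (w k).2 else 0) - d k) nN).
    by rewrite ltnSn.
  by move=> t; rewrite vpolyB -vpolyW // wV /G /= Fd.
rewrite -w1 (series_comp_vpoly (c := fun k =>
    (if (k < n.+1)%N then (w k).1 else 0, d k)) nN).
  by rewrite ltnSn -w2 -surjective_pairing.
by move=> t; rewrite vpoly_pair Fd -vpolyW.
Qed.

End QuadraticMaps.

(** * Rooted trees and product rules *)

Section Trees.

Lemma ptree_ind_mem (P : ptree -> Prop) :
  (forall ts, (forall t, t \in ts -> P t) -> P (Node ts)) -> forall t, P t.
Proof.
move=> PN; apply: ptree_all_ind => ts IH; apply: PN.
elim: ts IH => //= s ts IHts [Ps /IHts Pts] t.
by rewrite inE => /predU1P[->|/Pts].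
Qed.

Definition leaf := Node [::].

Definition children (t : ptree) := let: Node ts := t in ts.

(** For a single tree in [ts] this is the Butcher product. *)
Definition attach (t : ptree) (ts : seq ptree) := Node (children t ++ ts).

Let tle (s t : ptree) : bool := (choice.pickle s <= choice.pickle t)%N.

Let tle_total : total tle. Proof. by move=> s t; exact: leq_total. Qed.

Let tle_trans : transitive tle. Proof. by move=> t s u; exact: leq_trans. Qed.

Let tle_anti : antisymmetric tle.
Proof. by move=> s t /anti_leq /(pcan_inj (@choice.pickleK _)). Qed.

(** The canonical plane representative of the underlying unordered tree. *)
Fixpoint canon (t : ptree) : ptree :=
  let: Node ts := t in Node (sort tle (map canon ts)).

Lemma canonical_children t s : canonical t -> s \in children t -> canonical s.
Proof. by case: t => ts /= /andP[_ /allP]; exact. Qed.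

Lemma canonical_canon t : canonical (canon t).
Proof.
elim/ptree_ind_mem: t => ts IH /=; rewrite sort_sorted //=.
by rewrite all_sort; apply/allP => _ /mapP[s /IH + ->].
Qed.

Lemma canon_id t : canonical t -> canon t = t.
Proof.
elim/ptree_ind_mem: t => ts IH /= /andP[sts /allP cts].
rewrite (_ : map canon ts = ts) ?(sorted_sort tle_trans sts) //.
by rewrite -[RHS]map_id; apply/eq_in_map => s sts'; rewrite IH // cts.
Qed.

Lemma canon_perm ts us : perm_eq ts us -> canon (Node ts) = canon (Node us).
Proof.
move=> tsus /=; congr Node; apply/(perm_sortP tle_total tle_trans tle_anti).
exact: perm_map.
Qed.

(** Turns the matching of factors with directions in a derivative into an equality of trees. The
    conjunct [all canonical ts] is there because [canon] also reorders below the root, which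
    [perm_eq] does not. *)
Lemma canonical_perm_eq t ts : canonical t ->
  perm_eq (children t) ts = (all canonical ts) && (t == canon (Node ts)).
Proof.
case: t => us ct /=; have /= cus := @canonical_children _ _ ct.
apply/idP/andP => [pts|[/allP cts /eqP[->]]].
  split; first by apply/allP => s; rewrite -(perm_mem pts); exact: cus.
  by rewrite -[X in X == _](canon_id ct); apply/eqP/(canon_perm pts).
rewrite perm_sort (_ : map canon ts = ts) //.
by rewrite -[RHS]map_id; apply/eq_in_map => s /cts; exact: canon_id.
Qed.

Lemma canon_attach t ts : canon (attach (canon t) (map canon ts)) = canon (attach t ts).
Proof.
case: t => us; rewrite /attach.
rewrite (@canon_perm _ (map canon (us ++ ts))) /=; last first.
  by rewrite map_cat perm_cat2r perm_sort.
congr (Node (sort _ _)); rewrite -map_comp; apply/eq_in_map => s _ /=.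
by rewrite canon_id // canonical_canon.
Qed.

Lemma attach0 t : attach t [::] = t.
Proof. by case: t => ts; rewrite /attach cats0. Qed.

Lemma attach_cat t ts us : attach (attach t ts) us = attach t (ts ++ us).
Proof. by rewrite /attach /= catA. Qed.

Lemma nb_vertices_Node ts : nb_vertices (Node ts) = (\sum_(t <- ts) nb_vertices t).+1.
Proof. by rewrite /= sumnE big_map. Qed.

Lemma nb_vertices_gt0 t : (0 < nb_vertices t)%N.
Proof. by case: t. Qed.

Lemma nb_vertices_children t s : s \in children t -> (nb_vertices s < nb_vertices t)%N.
Proof.
by case: t => ts sts; rewrite nb_vertices_Node ltnS (big_rem _ sts) /= leq_addr.
Qed.

Lemma size_children t : (size (children t) < nb_vertices t)%N.
Proof.
case: t => ts; rewrite nb_vertices_Node ltnS -sum1_size leq_sum // => t _.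
exact: nb_vertices_gt0.
Qed.

Lemma nb_vertices_attach t ts :
  nb_vertices (attach t ts) = (nb_vertices t + \sum_(s <- ts) nb_vertices s)%N.
Proof. by case: t => us; rewrite !nb_vertices_Node big_cat. Qed.

Lemma nb_vertices_attach_rem t ts : t \in ts ->
  nb_vertices (attach t (rem t ts)) = (\sum_(s <- ts) nb_vertices s)%N.
Proof. by move=> tts; rewrite nb_vertices_attach (big_rem _ tts). Qed.

Lemma nb_vertices_canon t : nb_vertices (canon t) = nb_vertices t.
Proof.
elim/ptree_ind_mem: t => ts IH; rewrite /= !sumnE !big_map; congr S.
rewrite (perm_big _ (permEl (perm_sort _ _))) big_map.
by rewrite big_seq [RHS]big_seq; apply: eq_bigr => s /IH.
Qed.

Lemma tree_factorial_Node ts : tree_factorial (Node ts)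
  = (nb_vertices (Node ts) * \prod_(t <- ts) tree_factorial t)%N.
Proof. by rewrite /= foldrE big_map. Qed.

Lemma tree_factorial_gt0 t : (0 < tree_factorial t)%N.
Proof.
elim/ptree_ind_mem: t => ts IH; rewrite tree_factorial_Node muln_gt0 /=.
by rewrite big_seq; apply: prodn_cond_gt0.
Qed.

Lemma tree_factorial_canon t : tree_factorial (canon t) = tree_factorial t.
Proof.
elim/ptree_ind_mem: t => ts IH.
rewrite tree_factorial_Node -(nb_vertices_canon (Node ts)) /canon -/canon.
rewrite tree_factorial_Node; congr muln.
rewrite (perm_big _ (permEl (perm_sort _ _))) big_map.
by rewrite big_seq [RHS]big_seq; apply: eq_bigr => s /IH.
Qed.

(** Both sides are the two vertex counts times the factorials of all root branches; multiplying out
    avoids division in [nat]. *)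
Lemma tree_factorial_attach t ts :
  (tree_factorial (attach t ts) * nb_vertices t
    = nb_vertices (attach t ts) * (tree_factorial t * \prod_(s <- ts) tree_factorial s))%N.
Proof.
case: t => us; rewrite /attach !tree_factorial_Node big_cat /= -!mulnA; congr muln.
by rewrite mulnA mulnC.
Qed.

Lemma rem_perm (T : eqType) (x : T) s t : perm_eq s (x :: t) -> perm_eq (rem x s) t.
Proof.
move=> st; have xs : x \in s by rewrite (perm_mem st) mem_head.
by rewrite -(perm_cons x) -(permPl (perm_to_rem xs)).
Qed.

End Trees.

(** * Product rules for functions on trees *)

Section ProductRule.
Variable R : numFieldType.
Implicit Types (A : ptree -> R) (t u v w : ptree) (ts us : seq ptree).

(** For two trees this is the classical condition for a B-series to preserve quadratic invariants.
    [rem] deletes a single occurrence, so a repeated tree contributes once per occurrence. *)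
Definition product_rule A us :=
  \prod_(u <- us) A u = \sum_(u <- us) A (attach u (rem u us)).

Definition canon_invariant A := forall t, A (canon t) = A t.

Lemma attach_perm A u ts us : canon_invariant A -> perm_eq ts us ->
  A (attach u ts) = A (attach u us).
Proof.
move=> Ac tsus; rewrite -[LHS]Ac -[RHS]Ac; congr A; apply: canon_perm.
by rewrite perm_cat2l.
Qed.

(** Reduces the rule to canonical trees, where isomorphism is equality. *)
Lemma product_rule_canon A us : canon_invariant A ->
  product_rule A (map canon us) -> product_rule A us.
Proof.
move=> Ac; rewrite /product_rule !big_map.
under eq_bigr do rewrite Ac; move=> ->.
rewrite big_seq [RHS]big_seq; apply: eq_bigr => u uus.
rewrite -[RHS]Ac -canon_attach Ac; apply: attach_perm => //.
by apply: rem_perm; rewrite -map_cons perm_map // perm_to_rem.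
Qed.

Section Extension.
Variable A : ptree -> R.
Hypothesis Ac : canon_invariant A.
Hypothesis rule2 : forall u v, product_rule A [:: u; v].
Hypothesis rule3 : forall u v w, product_rule A [:: u; v; w].

Let A2 u v : A u * A v = A (attach u [:: v]) + A (attach v [:: u]).
Proof.
have := rule2 u v; rewrite /product_rule !big_cons !big_nil mulr1 addr0 => ->.
congr (_ + _); apply: attach_perm => //; apply: rem_perm => //.
by rewrite (perm_catC [:: u] [:: v]).
Qed.

Let A3 u v w : A u * A v * A w
  = A (attach u [:: v; w]) + A (attach v [:: u; w]) + A (attach w [:: u; v]).
Proof.
have := rule3 u v w; rewrite /product_rule !big_cons !big_nil mulr1 addr0 mulrA addrA => ->.
congr (_ + _ + _); apply: attach_perm => //; apply: rem_perm => //.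
  by rewrite (perm_cat2r [:: w] [:: u; v] [:: v; u]) (perm_catC [:: u] [:: v]).
by rewrite (perm_catC [:: u; v] [:: w]).
Qed.

(* Expand A p * A u * A v by rule3, and by rule2 applied twice. *)
Lemma attach_pair p u v : A (attach p [:: u; v])
  = A (attach p [:: attach u [:: v]]) + A (attach p [:: attach v [:: u]]).
Proof.
have e1 := A2 p (attach u [:: v]); have e2 := A2 p (attach v [:: u]).
have := A3 p u v; rewrite -mulrA A2 mulrDr e1 e2 !attach_cat /=.
rewrite (attach_perm u _ (permEl (perm_catC [:: v] [:: p]))) //.
rewrite (attach_perm v _ (permEl (perm_catC [:: u] [:: p]))) //= => e3.
apply: (@addIr _ (A (attach u [:: p; v]) + A (attach v [:: p; u]))).
by rewrite addrA -e3 addrACA.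
Qed.

(* Merge the first two trees of the list in both possible ways. *)
Lemma product_rule_all u us : product_rule A (u :: us).
Proof.
have [n] := ubnP (size us); elim: n u us => // n IH u [|v us] /=.
  by rewrite /product_rule !big_seq1 /= eqxx attach0.
rewrite ltnS => usn; rewrite /product_rule !big_cons mulrA A2 mulrDl.
have := IH (attach u [:: v]) us usn; have := IH (attach v [:: u]) us usn.
rewrite /product_rule !big_cons /= !eqxx !attach_cat /= => -> ->.
rewrite addrACA [RHS]addrA; congr (_ + _ + _).
  by apply: attach_perm => //; case: eqP => [->|].
(* For [w] in [us], this is [attach_pair] at the tree obtained from [w] by grafting the rest of [us]
   onto it. *)
rewrite -big_split big_seq [RHS]big_seq; apply: eq_bigr => w wus /=.
have wp ts : perm_eq (rem w (ts ++ us)) (rem w us ++ ts).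
  apply: rem_perm; rewrite perm_catC.
  by rewrite -cat_cons perm_cat2r perm_to_rem.
rewrite (attach_perm w _ (wp [:: _])) // (attach_perm w _ (wp [:: attach v _])) //.
by rewrite (attach_perm w _ (wp [:: u; v])) // -!attach_cat -attach_pair.
Qed.

End Extension.

Lemma product_rule_unique A E : canon_invariant A -> canon_invariant E ->
  (forall u us, product_rule A (u :: us)) ->
  (forall u us, product_rule E (u :: us)) ->
  A leaf = E leaf -> A =1 E.
Proof.
move=> Ac Ec Ar Er AEl t; have [n] := ubnP (nb_vertices t).
elim: n t => // n IHn t; rewrite ltnS => tn.
(* Downward induction on the root degree, which stays below [n]. *)
have [k] := ubnP (n - size (children t)).
elim: k t tn => // k IHk [ts] tn tk.
pose D s := A s - E s.
(* The rule is used for [leaf :: ts]: grafting [ts] onto [leaf] gives back [Node ts], while the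
   product involves only [leaf] and trees of smaller order. *)
have prodAE : \prod_(s <- leaf :: ts) A s = \prod_(s <- leaf :: ts) E s.
  rewrite !big_cons AEl; congr (_ * _); rewrite big_seq [RHS]big_seq.
  apply: eq_bigr => s sts; apply: IHn.
  by apply: leq_trans tn; exact: (@nb_vertices_children (Node ts)).
(* Every term with s != leaf has a root of degree larger than size ts. *)
have : \sum_(s <- leaf :: ts) D (attach s (rem s (leaf :: ts))) = 0.
  by rewrite sumrB -(Ar leaf ts) -(Er leaf ts) prodAE subrr.
rewrite big_seq (eq_bigr (fun s => D (Node ts) *+ (s == leaf))); last first.
  move=> s sts; have [->|sl] := eqVneq s leaf; first by rewrite /= ?eqxx.
  have nbs := nb_vertices_attach_rem sts.
  apply/eqP; rewrite mulr0n subr_eq0; apply/eqP/IHk.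
    by rewrite nbs big_cons /= add1n -nb_vertices_Node.
  have -> : size (children (attach s (rem s (leaf :: ts)))) = (size (children s) + size ts)%N.
    by rewrite size_cat size_rem.
  rewrite /= in tk.
  have : (size ts < n)%N by apply: leq_trans tn; exact: (size_children (Node ts)).
  have : (0 < size (children s))%N by case: (s) sl => -[].
  lia.
(* What remains is [D (Node ts)] times the number of leaves in [leaf :: ts], a positive integer. *)
rewrite -big_seq big_cons eqxx mulr1n sumrMnr -mulrS => /eqP.
by rewrite mulrn_eq0 /= subr_eq0 => /eqP.
Qed.

(** By [tree_factorial_attach], the summand of [t] is the left-hand product times [nb_vertices t]
    divided by the total order [n], and the vertex counts add up to [n]. *)
Lemma product_rule_exact_flow (c : R) u us :
  product_rule (fun t => c ^+ nb_vertices t / (tree_factorial t)%:R) (u :: us).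
Proof.
set s := u :: us; rewrite /product_rule.
set n := (\sum_(t <- s) nb_vertices t)%N.
have n0 : n%:R != 0 :> R.
  by rewrite pnatr_eq0 -lt0n /n big_cons ltn_addr // nb_vertices_gt0.
set g := (\prod_(t <- s) tree_factorial t)%N.
have g0 : g%:R != 0 :> R.
  by rewrite pnatr_eq0 -lt0n prodn_gt0 // => t; exact: tree_factorial_gt0.
rewrite prodf_div -natr_prod -/g prodrXr -/n.
rewrite big_seq (eq_bigr (fun t => c ^+ n / (n%:R * g%:R) * (nb_vertices t)%:R)).
  by rewrite -big_seq -mulr_sumr -natr_sum -/n; field; rewrite n0 g0.
move=> t ts; rewrite (nb_vertices_attach_rem ts) -/n -!mulrA; congr (_ * _).
have tf0 : (tree_factorial (attach t (rem t s)))%:R != 0 :> R.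
  by rewrite pnatr_eq0 -lt0n tree_factorial_gt0.
apply: (mulfI tf0); rewrite mulfV // mulrCA.
rewrite -(natrM _ (tree_factorial (attach _ _))) tree_factorial_attach.
rewrite (nb_vertices_attach_rem ts) -/n.
have -> : (tree_factorial t * \prod_(s0 <- rem t s) tree_factorial s0 = g)%N.
  by rewrite /g (big_rem _ ts).
by rewrite natrM mulVf // mulf_neq0.
Qed.

End ProductRule.

(** * Elementary differentials of monomial fields *)

Section MonomialFields.
Context {R : realType} (Y : completeNormedModType R).
Local Notation RR := (R : completeNormedModType R).
Variable coord : ptree -> {linear Y -> RR}.
Hypothesis coord_norm : forall s, exists C : R, forall y, `|coord s y| <= C * `|y|.
Implicit Types (s t u : ptree) (ss ts us : seq ptree).

Definition monomial ss (y : Y) : R := \prod_(s <- ss) coord s y.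

Let pairing s (y : Y) (r : RR) : RR := coord s y * r.

(** The recursion copies the formula of [sderivs_bilin] for one coordinate times the remaining
    monomial. *)
Fixpoint monomial_nderiv ss (y : Y) (vs : seq Y) : R :=
  if ss is s :: ss' then
    coord s y * monomial_nderiv ss' y vs
      + leibniz (pairing s) (monomial_nderiv ss' y) [::] vs
  else if vs is [::] then 1 else 0.

Lemma sderivs_monomial ss :
  sderivs (monomial ss : Y -> RR) (monomial_nderiv ss : Y -> seq Y -> RR).
Proof.
elim: ss => [|s ss IH].
  rewrite (_ : monomial [::] = fun=> 1); last by apply/funext => y; rewrite /monomial big_nil.
  exact: sderivs_cst.
rewrite (_ : monomial _ = fun y => pairing s y (monomial ss y)); last first.
  by apply/funext => y; rewrite /monomial big_cons.
have [C HC] := coord_norm s.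
apply: (@sderivs_bilin R Y RR RR (pairing s) _ _ C) => //.
- by move=> c y1 y2 r; rewrite /pairing linearP mulrDl -scalerAl.
- by move=> c y1 r1 r2; rewrite /pairing mulrDr -scalerAr.
- by move=> y r; rewrite /pairing normrM mulrA ler_wpM2r.
Qed.

Lemma monomial_perm ss ts : perm_eq ss ts -> monomial ss = monomial ts.
Proof. by move=> p; apply/funext => y; exact: perm_big. Qed.

Lemma monomial_cat ss ts y : monomial (ss ++ ts) y = monomial ss y * monomial ts y.
Proof. exact: big_cat. Qed.

Lemma diff_monomial ss y h : 'd (monomial ss : Y -> RR) y h
  = \sum_(s <- ss) coord s h * monomial (rem s ss) y.
Proof.
have -> : 'd (monomial ss : Y -> RR) y h = monomial_nderiv ss y [:: h].
  exact: (nderiv_sderivs (sderivs_monomial ss) [:: h] y).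
elim: ss => [|s ss IH]; first by rewrite big_nil.
rewrite big_cons /= eqxx addrC addr0; congr (_ + _).
  by rewrite /pairing; have [-> _ _ _] := sderivs_monomial ss.
rewrite IH mulr_sumr big_seq [RHS]big_seq; apply: eq_bigr => u uss.
rewrite -[if _ then _ else _]/(rem u (s :: ss)).
rewrite (@monomial_perm (rem u (s :: ss)) (s :: rem u ss)); last first.
  apply: rem_perm; apply/permP => a.
  by rewrite /= (permP (perm_to_rem uss)) /= addnCA.
by rewrite mulrCA /monomial big_cons.
Qed.

(* The number of permutations fixing the list ts. *)
Definition count_perms ts := (\prod_(s <- undup ts) (count_mem s ts)`!)%N.

Lemma count_perms_perm ts us : perm_eq ts us -> count_perms ts = count_perms us.
Proof.
move=> tsus; rewrite /count_perms (perm_big _ (perm_undup (perm_mem tsus))) /=.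
by apply: eq_bigr => s _; rewrite (permP tsus).
Qed.

Lemma count_perms_cons s ts :
  count_perms (s :: ts) = ((count_mem s ts).+1 * count_perms ts)%N.
Proof.
rewrite /count_perms /=; case: ifPn => sts.
  have sts' : s \in undup ts by rewrite mem_undup.
  rewrite !(bigD1_seq s) ?undup_uniq //= eqxx add1n factS -mulnA.
  by congr (_ * (_ * _))%N; apply: eq_bigr => x /negPf; rewrite eq_sym => ->.
rewrite big_cons (count_memPn sts) /= eqxx ?addn0 !mul1n.
rewrite big_seq [RHS]big_seq; apply: eq_bigr => x; rewrite mem_undup => xts.
have : x != s by apply: contraNneq sts => <-.
by rewrite eq_sym => /negPf /= ->.
Qed.

(** * Derivatives of monomials at the origin along dual directions *)

Section Values.
Variables (v : ptree -> Y) (w : ptree -> R) (dom : seq ptree).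

(** By duality only the entries of [ts] equal to [s] contribute. Each contribution leaves the list
    with one copy of [s] removed, and since [Q] is symmetric they all agree. *)
Lemma leibniz_values s (E : seq Y -> RR) (Q : seq ptree -> R) ps ts :
  (forall t, t \in dom -> coord s (v t) = (s == t)%:R * w t) ->
  (forall us, {subset us <= dom} -> E (map v us) = Q us) ->
  (forall us us', perm_eq us us' -> Q us = Q us') ->
  {subset ps <= dom} -> {subset ts <= dom} ->
  leibniz (pairing s) E (map v ps) (map v ts)
    = (count_mem s ts)%:R * w s * Q (ps ++ rem s ts).
Proof.
move=> sv EQ Qp; elim: ts ps => [|t ts IH] ps psD tsD; first by rewrite /= !mul0r.
have tD : t \in dom by apply: tsD; rewrite mem_head.
have tsD' : {subset ts <= dom} by move=> x xts; apply: tsD; rewrite inE xts orbT.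
have pstD : {subset rcons ps t <= dom}.
  by move=> x; rewrite mem_rcons inE => /predU1P[->//|]; exact: psD.
rewrite /= -map_cat -map_rcons IH // EQ; last first.
  by move=> x; rewrite mem_cat => /orP[/psD|/tsD'].
rewrite /pairing sv // [t == s]eq_sym; have [<-|st] := eqVneq s t; last first.
  by rewrite mul0r mul0r add0r add0n cat_rcons.
rewrite mul1r natrD !mulrDl mul1r; congr (_ + _).
have [sts|/count_memPn ->] := boolP (s \in ts); last by rewrite !mul0r.
congr (_ * _); apply: Qp; rewrite cat_rcons perm_cat2l perm_sym.
exact: perm_to_rem.
Qed.

(** At the origin only the terms in which every factor is differentiated survive. They match factors
    with directions, duality allows only matches between equal trees, and [count_perms ts] counts
    these matchings. *)
Lemma monomial_nderiv_values ss ts :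
  (forall s, coord s 0 = 0) ->
  (forall s t, s \in ss -> t \in dom -> coord s (v t) = (s == t)%:R * w t) ->
  {subset ts <= dom} ->
  monomial_nderiv ss 0 (map v ts)
    = (perm_eq ss ts)%:R * (count_perms ts)%:R * \prod_(t <- ts) w t.
Proof.
move=> coord0; elim: ss ts => [|s ss IH] ts sv tsD.
  case: ts tsD => [|t ts] _ /=; last first.
    by rewrite (_ : perm_eq _ _ = false) ?mul0r //; apply/negP => /perm_size.
  by rewrite /count_perms !big_nil !mulr1.
pose Q us : R := (perm_eq ss us)%:R * (count_perms us)%:R * \prod_(t <- us) w t.
rewrite /= coord0 mul0r add0r.
rewrite (@leibniz_values s _ Q [::] ts) //; first last.
- move=> us us' p; rewrite /Q (count_perms_perm p) (perm_big _ p).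
  by rewrite (permPr p).
- by move=> us usD; apply: IH => // x t xss; apply: sv; rewrite inE xss orbT.
- by move=> t; apply: sv; rewrite mem_head.
have [sts|sts] := boolP (s \in ts); last first.
  rewrite (count_memPn sts) (_ : perm_eq _ _ = false) ?mul0r //.
  by apply: contraNF sts => /perm_mem <-; rewrite mem_head.
have p := perm_to_rem sts.
rewrite (permPr p) perm_cons (count_perms_perm p) (perm_big _ p) big_cons.
rewrite count_perms_cons (permP p) /= eqxx add1n natrM /Q /=.
by ring.
Qed.

End Values.

Section TreeCoordinates.
Variables (f : Y -> Y) (n : nat).
Hypothesis smooth_f : smooth f.
Hypothesis coord_f : forall t, canonical t -> (nb_vertices t <= n)%N ->
  forall y, coord t (f y) = monomial (children t) y.

Lemma symmetry_Node ts :
  symmetry (Node ts) = (count_perms ts * \prod_(t <- ts) symmetry t)%N.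
Proof. by rewrite /= foldrE big_map. Qed.

Let eld t := elementary_differential f t 0.

Lemma nderiv_monomial_eld us ts :
  (forall s t, s \in us -> t \in ts -> coord s (eld t) = (s == t)%:R * (symmetry t)%:R) ->
  nderiv (monomial us : Y -> RR) (map eld ts) 0
    = (perm_eq us ts)%:R * (symmetry (Node ts))%:R.
Proof.
move=> usts; rewrite (nderiv_sderivs (sderivs_monomial us)).
rewrite (@monomial_nderiv_values eld (fun t => (symmetry t)%:R) ts) //.
  by rewrite symmetry_Node natrM natr_prod mulrA.
by move=> s; rewrite linear0.
Qed.

(** [coord s] of [f] is the monomial of the children of [s]. Its derivative along the differentials
    of the children of [t] is known by induction: the children have to match up to order, and the
    number of matchings is the root's share of [symmetry t]. *)
Lemma coord_elementary_differential s t : canonical s -> canonical t ->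
  (nb_vertices s <= n)%N -> coord s (eld t) = (s == t)%:R * (symmetry t)%:R.
Proof.
move=> + + sn; elim/ptree_ind_mem: t s sn => ts IH s sn cs cts.
have [C HC] := coord_norm s.
have := nderiv_sderivs (sderivs_linl HC (smooth_sderivs smooth_f)) (map eld ts) 0.
rewrite {2}/eld /= => <-.
rewrite (_ : (fun y => _) = monomial (children s)); last exact/funext/coord_f.
rewrite nderiv_monomial_eld; last first.
  move=> x t xs tts; apply: IH => //.
  - exact: leq_trans (ltnW (nb_vertices_children xs)) sn.
  - exact: canonical_children xs.
  - exact: (@canonical_children (Node ts)).
congr (_%:R * _); rewrite canonical_perm_eq // (canon_id cts).
by move: cts => /= /andP[_ ->].
Qed.

End TreeCoordinates.
End MonomialFields.

(** * Cubic equivariance *)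

HB.instance Definition _ (R : realType) (n : nat) :=
  Uniform_isComplete.Build 'rV[R]_n (@cauchy_cvg _).

Section CubicEquivariance.
Context {R : realType}.
Implicit Types (Y Z : completeNormedModType R).
Local Notation RR := (R : completeNormedModType R).

Lemma sderivs_ext Y Z (f f' : Y -> Z) E E' :
  f =1 f' -> E =2 E' -> sderivs f E -> sderivs f' E'.
Proof. by move=> /funext -> EE'; have -> : E = E' by apply/funext => y; exact/funext. Qed.

Lemma sderivs_sum Y Z (I : Type) (r : seq I) (f : I -> Y -> Z) E :
  (forall i, sderivs (f i) (E i)) ->
  sderivs (fun y => \sum_(i <- r) f i y) (fun y vs => \sum_(i <- r) E i y vs).
Proof.
move=> fE; elim: r => [|i r IH].
  apply: sderivs_ext (sderivs_cst Y 0) => y; first by rewrite big_nil.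
  by case=> *; rewrite big_nil.
by apply: sderivs_ext (sderivsD (fE i) IH) => y *; rewrite big_cons.
Qed.

Lemma smooth_row Y n (f : 'I_n -> Y -> RR) : (forall i, smooth (f i)) ->
  smooth (fun y => \row_i f i y : 'rV[R]_n).
Proof.
move=> sf.
have el i : linear (fun r : RR => r *: delta_mx 0 i : 'rV[R]_n).
  by move=> c u v; rewrite scalerDl scalerA.
have eb i r : `|linear_of (el i) r| <= `|delta_mx 0 i : 'rV[R]_n| * `|r|.
  by rewrite /= normrZ mulrC.
have sF := sderivs_smooth (sderivs_sum (index_enum 'I_n)
  (fun i => sderivs_linl (eb i) (smooth_sderivs (sf i)))).
suff -> : (fun y => \row_i f i y) = (fun y => \sum_(i <- index_enum 'I_n) linear_of (el i) (f i y)).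
  exact: sF.
apply/funext => y.
by rewrite [LHS]row_sum_delta; apply: eq_bigr => i _; rewrite mxE.
Qed.

Lemma tree_coordinates n : exists Y (coord : ptree -> {linear Y -> RR}) (f : Y -> Y),
  [/\ forall s, exists C : R, forall y, `|coord s y| <= C * `|y|, smooth f &
   forall t, canonical t -> (nb_vertices t <= n)%N ->
   forall y, coord t (f y) = monomial coord (children t) y].
Proof.
have [T HT] : exists T : seq ptree,
    forall t, canonical t -> (nb_vertices t <= n)%N -> t \in T.
  exists (flatten [seq [seq plane t | t <- fset_set (trees_of_order m)] | m <- iota 0 n.+1]).
  move=> t ct tn; apply/flatten_mapP; exists (nb_vertices t).
    by rewrite mem_iota add0n ltnS.
  apply/mapP; exists (RTree ct) => //.
  by rewrite in_fset_set ?inE //; exact: finite_trees_of_order.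
(* The extra coordinate receives the trees outside [T], for which [index] returns [size T]. *)
pose N := (size T).+1.
have cl t : linear (fun y : 'rV[R]_N => y 0 (inord (index t T)) : RR).
  by move=> c u v; rewrite !mxE.
pose coord t := linear_of (cl t).
have cb s : exists C : R, forall y, `|coord s y| <= C * `|y|.
  have [|C _ HC] := @continuous_linear_norm R 'rV[R]_N RR (coord s); last by exists C.
  exact: coord_continuous.
exists 'rV[R]_N, coord, (fun y => \row_j monomial coord (children (nth leaf T j)) y).
split=> //.
- apply: smooth_row => j; exact: sderivs_smooth (sderivs_monomial cb _).
- move=> t ct tn y; rewrite /= mxE inordK ?ltnS ?index_size //.
  by rewrite nth_index // HT.
Qed.

(** * Monomials as polynomial maps *)

Section Monomials.
Variables (Y : completeNormedModType R) (coord : ptree -> {linear Y -> RR}).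
Hypothesis coord_norm : forall s, exists C : R, forall y, `|coord s y| <= C * `|y|.

(** Factors and directions are paired in order, as [polynomial] does not ask for symmetric forms.
    The value 0 for different lengths leaves only the homogeneous part of degree [size ss]. *)
Fixpoint monomial_form (ss : seq ptree) (vs : seq Y) : RR :=
  match ss, vs with
  | [::], [::] => 1
  | s :: ss', v :: vs' => coord s v * monomial_form ss' vs'
  | _, _ => 0
  end.

Lemma monomial_polynomial d (ss : seq ptree) : (size ss <= d)%N ->
  polynomial d (monomial coord ss : Y -> RR).
Proof.
move=> ssd; exists (fun k vs => monomial_form ss vs); split.
- move=> k; apply: bounded_multilinear_seq.
    move=> p q c u v; elim: p ss {ssd} => [|w p IH] [|s ss] //=; rewrite ?scaler0 ?addr0 //.
      by rewrite linearP mulrDl scalerAl.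
    by rewrite IH mulrDr scalerAr.
  suff [C C0 HC] : exists2 C : R, 0 <= C &
      forall vs, `|monomial_form ss vs| <= C * \prod_(v <- vs) `|v|.
    by exists C => vs _.
  elim: ss {ssd} => [|s ss [C C0 HC]].
    exists 1 => // -[|v vs] /=; first by rewrite big_nil normr1 mulr1.
    by rewrite normr0 mulr_ge0 ?prodn_ge0.
  have [B HB] := coord_norm s.
  exists (`|B| * C) => [|[|v vs]] /=; first exact: mulr_ge0.
    by rewrite normr0 !mulr_ge0 ?prodn_ge0.
  rewrite big_cons normrM mulrACA ler_pM //.
  by rewrite (le_trans (HB _)) // ler_wpM2r ?ler_norm.
- move=> y; have mnE k : monomial_form ss (nseq k y)
      = if k == size ss then monomial coord ss y else 0.
    elim: ss k {ssd} => [|s ss IH] [|k] //=; first by rewrite /monomial big_nil.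
    by rewrite IH eqSS /monomial big_cons; case: ifP; rewrite ?mulr0.
  rewrite (bigD1 (Ordinal (ssd : (size ss < d.+1)%N))) //= mnE eqxx big1 ?addr0 // => k.
  by rewrite -val_eqE /= mnE => /negPf ->.
Qed.

End Monomials.

Variable a : rtree -> R.

Definition canonical_rtree (t : ptree) : rtree := RTree (canonical_canon t).

(** Extends [a] to all plane trees, because grafting does not preserve canonicity. *)
Definition weight (t : ptree) : R := a (canonical_rtree t).

Lemma weight_rtree (t : rtree) : weight t = a t.
Proof. by congr a; apply: val_inj; rewrite /= canon_id //; case: t. Qed.

Lemma canon_invariant_weight : canon_invariant weight.
Proof. by move=> t; congr a; apply: val_inj; rewrite /= canon_id // canonical_canon. Qed.

(** The symmetry factors cancel, and the indicator selects the canonical form of [u]. *)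
Lemma bseries_coefficient n (u : ptree) : nb_vertices u = n ->
  \sum_(t <- fset_set (trees_of_order n)) a t / (symmetry t)%:R
    * ((plane t == canon u)%:R * (symmetry t)%:R) = weight u.
Proof.
move=> un; have su : canonical_rtree u \in fset_set (trees_of_order n).
  rewrite in_fset_set; last exact: finite_trees_of_order.
  by rewrite inE /trees_of_order /= nb_vertices_canon.
have s0 (t : ptree) : (symmetry t)%:R != 0 :> R.
  rewrite pnatr_eq0 -lt0n; elim/ptree_ind_mem: t => ts IH.
  rewrite symmetry_Node muln_gt0; apply/andP; split.
    by apply: prodn_gt0 => s; exact: fact_gt0.
  by rewrite big_seq prodn_cond_gt0.
rewrite (bigD1_seq (canonical_rtree u)) ?fset_uniq //= eqxx mul1r divfK // big1 ?addr0 // => t.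
by rewrite -val_eqE /= => /negPf ->; rewrite mul0r mulr0.
Qed.

(** Equivariance is tested at the origin of the tree coordinates, in the second component and at the
    order [n] given by the total number of vertices in [us]. *)
Lemma cubic_product_rule (us : seq ptree) :
  functionally_equivariant (@cubic R) (bseries a) ->
  (0 < size us <= 3)%N -> product_rule weight us.
Proof.
move=> equi us3; apply: product_rule_canon; first exact: canon_invariant_weight.
have : all canonical (map canon us).
  by rewrite all_map; apply/allP => u _; exact: canonical_canon.
move: us3; rewrite -(size_map canon).
move: (map canon us) => {}us /andP[us0 us3] /allP cus.
set n := (\sum_(u <- us) nb_vertices u)%N.
have usn u : u \in us -> (nb_vertices u <= n)%N.
  by move=> uus; rewrite /n (big_rem _ uus) leq_addr.
have n0 : n != 0%N.
  have /hasP[u uus _] : has predT us by rewrite has_predT.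
  by rewrite -lt0n (leq_trans (nb_vertices_gt0 u)) ?usn.
have [Y [coord [f [cb sf cf]]]] := tree_coordinates n.
pose F : Y -> RR := monomial coord us.
have ldf u (t : rtree) : u \in us -> coord u (elementary_differential f t 0)
    = (u == t)%:R * (symmetry t)%:R.
  move=> uus; apply: (coord_elementary_differential cb sf cf); last exact: usn.
    exact: cus.
  exact: (valP t).
(* Differentiating the factor of [u] along [f] replaces it by the monomial of the children of [u];
   with the untouched factors this is the monomial of a grafted tree. *)
have hE y : 'd F y (f y)
    = \sum_(u <- us) monomial coord (children (attach u (rem u us))) y.
  rewrite (diff_monomial cb) big_seq [RHS]big_seq; apply: eq_bigr => u uus.
  by rewrite monomial_cat cf ?usn ?cus.
have := equi Y RR f F sf (monomial_polynomial cb us3).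
set g := (fun p => _) => /(_ 0) /(congr1 (fun u => (u n).2)).
pose h y : RR := 'd F y (f y).
have sh := sderivs_sum us
  (fun u => sderivs_monomial cb (children (attach u (rem u us)))).
rewrite -(funext hE : h = _) in sh.
have sg : sderivs g _ := sderivs_pair
  (sderivs_linr (@fst_norm R Y RR) (smooth_sderivs sf)) (sderivs_linr (@fst_norm R Y RR) sh).
have g_fst t p : (elementary_differential g t p).1 = elementary_differential f t p.1.
  exact: (@elementary_differential_linear R (Y * RR)%type Y g f fst _ (@fst_norm R Y RR)
    (sderivs_smooth sg) sf).
(* [g] depends on its first component alone, so the root is differentiated through [h] and the
   branches through [f]. *)
have g_snd (t : rtree) r : (elementary_differential g t (0, r)).2
    = \sum_(u <- us) (plane t == canon (attach u (rem u us)))%:R * (symmetry t)%:R.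
  case: t => -[ts] /= cts; rewrite (nderiv_sderivs sg) /= -map_comp.
  rewrite (eq_map (g := fun t => elementary_differential f t 0)); last first.
    by move=> t /=; rewrite g_fst.
  rewrite big_seq [RHS]big_seq; apply: eq_bigr => u uus.
  have cu : all canonical (children (attach u (rem u us))).
    rewrite all_cat; apply/andP; split; apply/allP => s.
      exact: canonical_children (cus _ uus).
    by move=> /mem_rem; exact: cus.
  rewrite -(nderiv_sderivs (sderivs_monomial cb _)) (nderiv_monomial_eld cb).
    by rewrite perm_sym (@canonical_perm_eq (Node ts)) // cu.
  move=> s t sch tts; apply: (coord_elementary_differential cb sf cf).
  - exact: (allP cu).
  - exact: (@canonical_children (Node ts)).
  - by rewrite -[n](nb_vertices_attach_rem uus) ltnW // nb_vertices_children.
(* By [ldf] only the tree [u] is seen by [coord u], so each of these coordinates is a single power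
   of time along the method. *)
have coord_bs u k : u \in us -> coord u (bseries a f 0 k)
    = if k == nb_vertices u then weight u else 0.
  move=> uus; have [->|k0] := eqVneq k 0%N.
    by rewrite /bseries /= linear0; case: eqP (nb_vertices_gt0 u) => // <-.
  rewrite linear_bseries //; case: eqP => [uk|uk].
    rewrite -[RHS](bseries_coefficient (esym uk)); apply: eq_bigr => t _.
    rewrite ldf // /GRing.scale /=.
    by rewrite eq_sym (canon_id (cus _ uus)).
  apply: big1_seq => t /= tk; have {}tk : nb_vertices t = k.
    by move: tk; rewrite in_fset_set ?inE //; exact: finite_trees_of_order.
  rewrite ldf //.
  rewrite (_ : _ == _ = false) ?mul0r ?scaler0 //.
  by apply/eqP => ut; apply: uk; rewrite -tk ut.
(* Multiplied over [us], these powers leave only order [n]; all of them survive the truncation since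
   their exponents are at most [n]. *)
rewrite (series_comp_vpoly (N := n.+1)
  (c := fun k => (bseries a f 0 k, if k == n then \prod_(u <- us) weight u else 0)
    : (Y * RR)%type)) //=; last first.
  move=> t; rewrite vpoly_pair; congr pair; rewrite /F /monomial.
  rewrite [RHS]/vpoly [RHS](bigD1 ord_max) //= eqxx [X in _ + X]big1 => [|k]; last first.
    by rewrite -val_eqE /= => /negPf ->; rewrite scaler0.
  have -> : t ^+ n = \prod_(u <- us) t ^+ nb_vertices u by rewrite prodrXr.
  rewrite addr0 [RHS]/GRing.scale /= -big_split big_seq [RHS]big_seq /=.
  apply: eq_bigr => u uus; rewrite vpoly_linear /vpoly /=.
  have un : (nb_vertices u < n.+1)%N by rewrite ltnS usn.
  rewrite (bigD1 (Ordinal un)) //= coord_bs // eqxx big1 ?addr0 // => k.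
  by rewrite -val_eqE /= coord_bs // => /negPf ->; rewrite scaler0.
rewrite eqxx /product_rule => ->.
rewrite (@linear_bseries R a (Y * RR)%type RR g snd) //.
under eq_bigr do rewrite /= g_snd /GRing.scale /= mulr_sumr.
rewrite exchange_big big_seq [RHS]big_seq; apply: eq_bigr => u uus.
exact: (bseries_coefficient (nb_vertices_attach_rem uus)).
Qed.

End CubicEquivariance.

Theorem corollary2p10 (R : realType) :
  (forall a : rtree -> R,
     functionally_equivariant (@affine R) (bseries a)) /\
  (forall a : rtree -> R,
     preserves_quadratic_invariants (bseries a) ->
     functionally_equivariant (@quadratic R) (bseries a)) /\
  (forall a : rtree -> R,
     ~ (exists c : R, a = exact_flow c) ->
     ~ functionally_equivariant (@cubic R) (bseries a)).
Proof.
split; first exact: affine_equivariance.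
split; first exact: quadratic_equivariance.
(* The exact flow with parameter [c] takes the value [c] at the leaf, which forces this witness. *)
move=> a na equi; apply: na; exists (a (canonical_rtree leaf)).
apply/funext => t; rewrite -weight_rtree.
have r k := @cubic_product_rule R a k equi.
set c := a _.
apply: (@product_rule_unique R (weight a)
  (fun t => c ^+ nb_vertices t / (tree_factorial t)%:R)).
- exact: canon_invariant_weight.
- by move=> u; rewrite nb_vertices_canon tree_factorial_canon.
- apply: product_rule_all => //; first exact: canon_invariant_weight.
    by move=> u v; exact: r.
  by move=> u v w; exact: r.
- exact: product_rule_exact_flow.
- by rewrite /= divr1 expr1.
Qed.
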